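(* Let $d>1$ be an integer and let $\boldsymbol{P}$ be a random $d$-state Markov chain, i.e. a random $d\times d$ row-stochastic matrix defined on a probability space $(\Omega,\mathcal{F},\mathbb{P})$, with rows $\boldsymbol{X}_1,\ldots,\boldsymbol{X}_d$. If $\boldsymbol{X}_1,\ldots,\boldsymbol{X}_d$ are independent and each $\boldsymbol{X}_i$ is continuous, then $\boldsymbol{P}$ is Benford with probability one.
   Context: Conventions: $\log$ denotes the base-$10$ logarithm; $A^{(i,j)}$ denotes the $(i,j)$ entry of a matrix $A$. Standard simplex: $\Delta_d:=\{(x_1,\ldots,x_d)\in\mathbb{R}^d: x_j\ge 0\text{ for all }1\le j\le d,\ \sum_{j=1}^d x_j=1\}$. $\mathcal{P}_d$ denotes the set of all row-stochastic $d\times d$ matrices, i.e. real matrices each of whose rows lies in $\Delta_d$. A random ($d$-state) Markov chain is a random $d\times d$ matrix $\boldsymbol{P}$ on a probability space $(\Omega,\mathcal{F},\mathbb{P})$ taking values in $\mathcal{P}_d$; its rows $\boldsymbol{X}_1,\ldots,\boldsymbol{X}_d$ are random vectors with values in $\Delta_d$. A random vector $\boldsymbol{X}:\Omega\to\Delta_d$ is continuous if its distribution is (absolutely) continuous with respect to the normalised Lebesgue measure on $\Delta_d$ (i.e. normalised $(d-1)$-dimensional Lebesgue measure), that is, if $\mathbb{P}(\boldsymbol{X}\in A)=0$ whenever $A\subset\Delta_d$ is a nullset. Significand: for $x>0$, $S(x)$ is the unique $s\in[1,10)$ with $x=10^ks$ for some $k\in\mathbb{Z}$; $S(0):=0$.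 A sequence $(x_n)$ of real numbers is Benford if $\lim_{n\to\infty}\frac{\#\{j\le n:S(|x_j|)\le t\}}{n}=\log t$ for all $t\in[1,10)$. A sequence is eventually zero if all but finitely many of its terms are $0$. Benford matrix: an irreducible and aperiodic matrix $P\in\mathcal{P}_d$, with $P^*=\lim_{n\to\infty}P^n$ (which exists), is Benford if for every $(i,j)\in\{1,\ldots,d\}^2$ each of the sequences $\bigl((P^n-P^* )^{(i,j)}\bigr)_{n\in\mathbb{N}}$ and $\bigl((P^{n+1}-P^n)^{(i,j)}\bigr)_{n\in\mathbb{N}}$ is either Benford or eventually zero. *)

(* Defs.v *)
From HB Require Import structures.
From mathcomp Require Import all_boot all_order all_algebra.
From mathcomp Require Import all_classical all_reals all_analysis.

Set Implicit Arguments.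
Unset Strict Implicit.
Unset Printing Implicit Defensive.

Import Order.TTheory GRing.Theory Num.Theory.
Import numFieldNormedType.Exports.

Local Open Scope classical_set_scope.
Local Open Scope ring_scope.

Lemma sigma_finite_product d1 d2 (T1 : measurableType d1)
    (T2 : measurableType d2) (R : realType)
    (m1 : {sigma_finite_measure set T1 -> \bar R})
    (m2 : {sigma_finite_measure set T2 -> \bar R}) :
  sigma_finite setT (m1 \x m2)%E.
Proof.
have /sigma_finiteP[F [TF ndF Foo]] := sigma_finiteT m1.
have /sigma_finiteP[G [TG ndG Goo]] := sigma_finiteT m2.
exists (fun n => F n `*` G n).
  rewrite -setXTT TF TG predeqE => -[x y]; split.
    move=> [/= [n _ Fnx] [k _ Gky]]; exists (maxn n k) => //; split.
    - by move: x Fnx; exact/subsetPset/ndF/leq_maxl.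
    - by move: y Gky; exact/subsetPset/ndG/leq_maxr.
  by move=> [n _ []/= ? ?]; split; exists n.
move=> k; have [? ?] := Foo k; have [? ?] := Goo k.
split; first exact: measurableX.
by rewrite product_measure1E// lte_mul_pinfty// ge0_fin_numE.
Qed.

Section lebesgue_tuple.
Context {R : realType}.

Definition cons_pair n (p : measurableTypeR R * n.-tuple R) : n.+1.-tuple R :=
  [tuple of p.1 :: p.2].

Lemma measurable_cons_pair n : measurable_fun setT (@cons_pair n).
Proof.
apply: (@measurable_cons _ _ _ R fst n snd); last exact: measurable_snd.
exact: (@measurable_fst _ _ (measurableTypeR R)).
Qed.

Section step.
Context n (mu : {sigma_finite_measure set (n.-tuple R) -> \bar R}).

Definition lebesgue_cons : set (n.+1.-tuple R) -> \bar R :=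
  pushforward (@lebesgue_measure R \x mu)%E (@cons_pair n).

Let lebesgue_cons0 : lebesgue_cons set0 = 0%E.
Proof. by rewrite /lebesgue_cons /pushforward preimage_set0 measure0. Qed.

Let lebesgue_cons_ge0 A : (0 <= lebesgue_cons A)%E.
Proof. by rewrite /lebesgue_cons /pushforward; exact: measure_ge0. Qed.

Let lebesgue_cons_sigma_additive : semi_sigma_additive lebesgue_cons.
Proof.
exact: (@measure_semi_sigma_additive _ _ _
  (measure_function_pushforward__canonical__measure_function_Measure
    (@lebesgue_measure R \x mu)%E (@measurable_cons_pair n))).
Qed.

HB.instance Definition _ := isMeasure.Build _ _ _ lebesgue_cons
  lebesgue_cons0 lebesgue_cons_ge0 lebesgue_cons_sigma_additive.

Let lebesgue_cons_sigma_finite : sigma_finite setT lebesgue_cons.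
Proof.
have [F FT mF] : sigma_finite setT (@lebesgue_measure R \x mu)%E.
  exact: sigma_finite_product.
pose split (t : n.+1.-tuple R) : measurableTypeR R * n.-tuple R :=
  (thead t, [tuple of behead t]).
have splitK t : cons_pair (split t) = t by rewrite [RHS]tuple_eta.
have consK p : split (cons_pair p) = p.
  by case: p => x s; congr pair; apply/val_inj.
have msplit : measurable_fun setT split.
  apply/measurable_fun_pairP; split.
    exact: (@measurable_tnth _ R n.+1 ord0).
  exact: measurable_behead.
exists (fun k => split @^-1` F k).
  by rewrite -preimage_bigcup -FT preimage_setT.
move=> k; have [mFk Fkoo] := mF k; split.
  by rewrite -[X in measurable X]setTI; exact: msplit.
rewrite /lebesgue_cons /pushforward.
rewrite (_ : _ @^-1` _ = F k)//.
by apply/seteqP; split => p /=; rewrite consK.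
Qed.

HB.instance Definition _ := Measure_isSigmaFinite.Build _ _ _ lebesgue_cons
  lebesgue_cons_sigma_finite.

End step.

(* [n]-dimensional Lebesgue measure on the Borel (= product) sigma-algebra, as
   an iterated product; [lebesgue_tuple_box] gives its value on boxes. *)
Fixpoint lebesgue_tuple n : {sigma_finite_measure set (n.-tuple R) -> \bar R} :=
  match n with
  | 0 => \d_([tuple] : 0.-tuple R)
  | m.+1 => lebesgue_cons (lebesgue_tuple m)
  end.

Lemma lebesgue_tuple_box n (A : 'I_n -> set R) :
    (forall i, measurable (A i)) ->
  lebesgue_tuple n [set t | forall i, A i (tnth t i)] =
    (\prod_(i < n) lebesgue_measure (A i))%E.
Proof.
elim: n A => [|n IH] A mA /=.
  by rewrite big_ord0 diracE mem_set// => -[].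
rewrite big_ord_recl -IH => [|i]; last exact: mA.
rewrite /lebesgue_cons /pushforward.
rewrite (_ : _ @^-1` _ =
    A ord0 `*` [set t | forall i, A (lift ord0 i) (tnth t i)]).
  rewrite product_measure1E//=; first exact: mA.
  rewrite (_ : mkset _ = \bigcap_i ((@tnth n R)^~ i @^-1` A (lift ord0 i))).
    apply: fin_bigcap_measurable => // i _.
    by rewrite -[X in measurable X]setTI; exact: measurable_tnth.
  by apply/seteqP; split => t /= h i; [move=> _|]; exact: h.
apply/seteqP; split => -[x t] /=.
  move=> h; split; first exact: (h ord0).
  by move=> i; have := h (lift ord0 i); rewrite tnthS.
move=> [h0 h] i; case: (fintype.unliftP ord0 i) => [j|] -> //.
by rewrite /cons_pair tnthS.
Qed.

End lebesgue_tuple.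

Section simplex.
Context {R : realType}.

Definition simplex d : set (d.-tuple R) :=
  [set x | (forall j, 0 <= tnth x j) /\ \sum_(j < d) tnth x j = 1].

(* The affine parametrisation (y_1, .., y_(d-1)) |-> (y_1, .., y_(d-1), 1 - sum y)
   of the hyperplane containing the simplex. *)
Definition simplex_chart d (y : d.-1.-tuple R) : d.-tuple R :=
  [tuple nth 0 (rcons y (1 - \sum_(k < d.-1) tnth y k)) j | j < d].

Lemma measurable_simplex d : measurable (@simplex d).
Proof.
rewrite (_ : @simplex d =
    (\bigcap_j ((@tnth d R)^~ j @^-1` `[0, +oo[)) `&`
    ((fun x : d.-tuple R => \sum_(j < d) tnth x j) @^-1` [set 1])); last first.
  apply/seteqP; split => x /= -[h1 h2]; split => // j; first by move=> _ /=; rewrite in_itv/= andbT.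
  by have := h1 j Logic.I; rewrite /= in_itv/= andbT.
apply: measurableI.
  apply: fin_bigcap_measurable => // i _.
  by rewrite -[X in measurable X]setTI; exact: measurable_tnth.
rewrite -[X in measurable X]setTI; apply: measurable_sum => //.
by move=> i; exact: measurable_tnth.
Qed.

Lemma measurable_simplex_chart d : measurable_fun setT (@simplex_chart d).
Proof.
apply/measurable_fun_tnthP => j; rewrite /comp.
under eq_fun do rewrite tnth_mktuple nth_rcons size_tuple.
have [jd|dj] := ltnP j d.-1.
  under eq_fun do rewrite -(tnth_nth 0 _ (Ordinal jd)).
  exact: measurable_tnth.
case: eqP => _; last exact: measurable_cst.
apply: measurable_realfun.measurable_funB; first exact: measurable_cst.
by apply: measurable_sum => k; exact: measurable_tnth.
Qed.

(* Normalised (d-1)-dimensional Lebesgue measure, carried by the simplex.  The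
   chart scales (d-1)-dimensional volume by a constant, and the parameter region
   { y | y_k >= 0, sum y <= 1 } has Lebesgue measure 1 / (d-1)!, whence the
   normalising factor. *)
Definition simplex_measure d (A : set (d.-tuple R)) : \bar R :=
  ((d.-1)`!%:R%:E *
    lebesgue_tuple d.-1 (@simplex_chart d @^-1` (A `&` @simplex d)))%E.

Section simplex_measure_instance.
Variable d : nat.

Let simplex_measure0 : @simplex_measure d set0 = 0%E.
Proof. by rewrite /simplex_measure set0I preimage_set0 measure0 mule0. Qed.

Let simplex_measure_ge0 A : (0 <= @simplex_measure d A)%E.
Proof. by rewrite mule_ge0// lee_fin. Qed.

Let simplex_measure_sigma_additive : semi_sigma_additive (@simplex_measure d).
Proof.
pose nu1 : {measure set (d.-tuple R) -> \bar R} :=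
  measure_function_pushforward__canonical__measure_function_Measure
    (@lebesgue_tuple R d.-1) (@measurable_simplex_chart d).
pose nu2 : {measure set (d.-tuple R) -> \bar R} :=
  mrestr nu1 (@measurable_simplex d).
exact: (@measure_semi_sigma_additive _ _ _ (mscale ((d.-1)`!%:R)%:nng nu2)).
Qed.

HB.instance Definition _ := isMeasure.Build _ _ _ (@simplex_measure d)
  simplex_measure0 simplex_measure_ge0 simplex_measure_sigma_additive.

End simplex_measure_instance.

End simplex.

Section random_vectors.
Context disp disp' (T : measurableType disp) (T' : measurableType disp').
Context {R : realType} (P : probability T R).

Definition mutually_independent (I : finType) (Y : I -> T -> T') : Prop :=
  forall (J : {set I}) (A : I -> set T'), (forall i, measurable (A i)) ->
    P (\bigcap_(i in [set` J]) (Y i @^-1` A i)) =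
    (\prod_(i in J) P (Y i @^-1` A i))%E.

(* By [null_content_dominatesP], this says that [P (Y @^-1` A) = 0] for every
   Borel set [A] with [simplex_measure A = 0]. *)
Definition continuous_random_vector d (Y : T -> d.-tuple R) : Prop :=
  pushforward P Y `<< @simplex_measure R d.

End random_vectors.

Section markov_chains.
Context {R : realType}.

(* Rows are tuples, as these carry a measurable structure in the library. *)
Definition row_tuple d (M : 'M[R]_d) (i : 'I_d) : d.-tuple R :=
  [tuple M i j | j < d].

Definition row_stochastic d : set 'M[R]_d :=
  [set M | forall i, simplex (row_tuple M i)].

Definition random_markov_chain disp (T : measurableType disp) d
    (X : T -> 'M[R]_d) : Prop :=
  (forall i j, measurable_fun setT (fun w => X w i j)) /\
  (forall w, row_stochastic (X w)).

Definition irreducible d (M : 'M[R]_d) : Prop :=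
  forall i j, exists2 n, (0 < n)%N & 0 < (M ^+ n) i j.

Definition is_gcd (N : set nat) (g : nat) : Prop :=
  (forall n, N n -> (g %| n)%N) /\
  (forall k, (forall n, N n -> (k %| n)%N) -> (k %| g)%N).

Definition aperiodic d (M : 'M[R]_d) : Prop :=
  forall i, is_gcd [set n | (0 < n)%N /\ 0 < (M ^+ n) i i] 1.

Definition limit_matrix d (M : 'M[R]_d) : 'M[R]_d := lim (M ^+ n @[n --> \oo]).

End markov_chains.

Section benford.
Context {R : realType}.

(* Only used for [0 <= x]; the set below is a singleton when [0 < x]. *)
Definition significand (x : R) : R :=
  if x == 0 then 0
  else xget 0 [set s | 1 <= s < 10 /\ exists k : int, x = 10 ^ k * s].

Definition log10 (t : R) : R := ln t / ln 10.

(* Sequences are indexed from 1: the value at 0 is never inspected. *)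
Definition benford (x : R^nat) : Prop :=
  forall t, 1 <= t < 10 ->
    (count (fun j => significand `|x j| <= t) (iota 1 n))%:R / n%:R
      @[n --> \oo] --> log10 t.

Definition eventually_zero (x : R^nat) : Prop := \forall n \near \oo, x n = 0.

Definition benford_matrix d (M : 'M[R]_d) : Prop :=
  [/\ row_stochastic M, irreducible M, aperiodic M &
    forall i j,
      let x n := (M ^+ n - limit_matrix M) i j in
      let y n := (M ^+ n.+1 - M ^+ n) i j in
      (benford x \/ eventually_zero x) /\ (benford y \/ eventually_zero y)].

End benford.

(* Main.v *)
Require Import Defs.
From HB Require Import structures.
From mathcomp Require Import all_boot all_order all_algebra.
From mathcomp Require Import all_classical all_reals all_analysis.
From mathcomp Require Import complex.
From mathcomp Require Import ring lra zify.

Set Implicit Arguments.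
Unset Strict Implicit.
Unset Printing Implicit Defensive.

Import Order.TTheory GRing.Theory Num.Theory.
Import numFieldNormedType.Exports.

Local Open Scope classical_set_scope.
Local Open Scope ring_scope.

(** The rows of [P] are almost surely positive, so only the spectrum matters.  Let
    [A] be the action of [P] on R^d modulo the constant vectors; its eigenvalues are
    those of [P] other than 1, and have modulus < 1 by an l^1 contraction.

    Deterministic part.  If all powers [A ^ k] have nonzero discriminant, the entries
    of [P ^ n - P^*] and [P ^ (n + 1) - P ^ n] are sums of c_r r ^ n over distinct
    eigenvalues r of [A] whose ratios are not roots of unity.  Such a sequence is
    x_n = L ^ n (u_n + o(1)) with L the largest modulus that occurs and u_n an almost
    periodic sequence, which is rarely close to 0.  By Weyl's criterion it is Benford
    as soon as the means of exp(2 i pi h log |x_n|) = exp(2 i pi h n log L) *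
    exp(2 i pi h log |u_n|) + o(1) vanish.  Approximating the last factor by a
    polynomial in |u_n|^2 leaves geometric sums, whose ratios differ from 1 unless a
    product of j eigenvalues of modulus L equals L ^ j exp(- 2 i pi h log L).

    Probabilistic part.  In the coordinates of the simplices the law of [P] is
    absolutely continuous, so a Borel set of matrices is negligible if some point C
    sees it along countably many points on each ray.  Zero discriminant is a
    polynomial condition on rays from a diagonal [A].  For the resonances take C = 0:
    moving along a ray multiplies all eigenvalues of [A] by a real s > 0, and L ^ j
    exp(- 2 i pi h log L) is an eigenvalue of the j-th Kronecker power of [s A] for
    countably many s only. *)

Local Open Scope complex_scope.

(** * Complex exponentials *)

(** The modulus L = exp t in a resonance is a continuous parameter: the forbidden values of a
    product of j eigenvalues fill a spiral, so the exceptional set is no algebraic zero set. Hence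
    the test by countable intersections with rays. A measurable choice of eigenvalues is avoided as
    well: the characteristic polynomial of a Kronecker power has coefficients polynomial in the
    entries, and the quantifier over t is made Borel by compactness and rational times.

    Exceptional sets live in the whole space of coordinates, the first d - 1 entries of every row,
    because rays leave the product of simplices. The quotient action A is linear in these
    coordinates, so a ray from 0 scales A exactly.

    If a ratio of eigenvalues were a root of unity, u_n could vanish along an arithmetic
    progression, and log |u_n| would be uncontrolled on a set of positive density. Conjugates of
    eigenvalues enter through |u_n|^2; as A is real they are eigenvalues again. *)

Section complex_exponential.
Context {R : realType}.
Implicit Types (x y : R) (z w : R[i]).

(** The norm of [R[i]] takes values in [R[i]]; this modulus is real, for use in limits and estimates
    over [R]. *)
Definition cnorm z : R := ComplexField.Normc.normc z.

Lemma cnorm_ge0 z : 0 <= cnorm z.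
Proof. by case: z => a b; exact: sqrtr_ge0. Qed.

Lemma cnormD z w : cnorm (z + w) <= cnorm z + cnorm w.
Proof. exact: le_normcD. Qed.

Lemma cnormN z : cnorm (- z) = cnorm z.
Proof. exact: normcN. Qed.

Lemma cnormM z w : cnorm (z * w) = cnorm z * cnorm w.
Proof. exact: ComplexField.Normc.normcM. Qed.

Lemma cnorm0 : cnorm (0 : R[i]) = 0.
Proof. exact: ComplexField.Normc.normc0. Qed.

Lemma cnorm1 : cnorm (1 : R[i]) = 1.
Proof. exact: ComplexField.Normc.normc1. Qed.

Lemma cnorm_eq0 z : (cnorm z == 0) = (z == 0).
Proof.
apply/eqP/eqP => [|->]; [exact: ComplexField.Normc.eq0_normc|exact: cnorm0].
Qed.

Lemma cnormB z w : cnorm (z - w) <= cnorm z + cnorm w.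
Proof. by rewrite -(cnormN w); exact: cnormD. Qed.

Lemma cnorm_distC z w : cnorm (z - w) = cnorm (w - z).
Proof. by rewrite -cnormN opprB. Qed.

Lemma cnorm_dist z w : `|cnorm z - cnorm w| <= cnorm (z - w).
Proof.
rewrite ler_norml; apply/andP; split.
  by rewrite lerNl opprB lerBlDr cnorm_distC -[leLHS]/(cnorm w) -{1}(subrK z w); exact: cnormD.
by rewrite lerBlDr -{1}(subrK w z); exact: cnormD.
Qed.

Lemma cnormX z n : cnorm (z ^+ n) = cnorm z ^+ n.
Proof.
by elim: n => [|n IH]; rewrite ?expr0 ?cnorm1// !exprS cnormM IH.
Qed.

Lemma cnormV z : cnorm z^-1 = (cnorm z)^-1.
Proof. exact: ComplexField.Normc.normcV. Qed.

Lemma cnormR x : cnorm x%:C = `|x|.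
Proof. by rewrite /cnorm/= expr0n addr0 sqrtr_sqr. Qed.

Lemma cnorm_i : cnorm 'i%C = 1.
Proof. by rewrite /cnorm/= expr0n expr1n add0r sqrtr1. Qed.

Lemma cnorm_conj z : cnorm z^* = cnorm z.
Proof. by case: z => a b; rewrite /cnorm/= sqrrN. Qed.

Lemma cnorm_sqr z : (cnorm z ^+ 2)%:C = z * z^*.
Proof.
rewrite -sqr_normc -[`|z|]/((cnorm z)%:C) rmorphXn //=.
Qed.

Lemma cnorm_sum (I : Type) (r : seq I) (P : pred I) (F : I -> R[i]) :
  cnorm (\sum_(i <- r | P i) F i) <= \sum_(i <- r | P i) cnorm (F i).
Proof.
elim/big_rec2 : _ => [|i u v _ h]; first by rewrite cnorm0.
by apply: (le_trans (cnormD _ _)); rewrite lerD2l.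
Qed.

(** exp(2 i pi x), of period 1, so that integer parts drop out. *)
Definition cis x : R[i] := cos (2 * pi * x) +i* sin (2 * pi * x).

Lemma cisD x y : cis (x + y) = cis x * cis y.
Proof.
rewrite /cis mulrDr cosD sinD; apply/eqP; rewrite eq_complex /=.
by rewrite eqxx /= addrC.
Qed.

Lemma cis0 : cis 0 = 1.
Proof. by rewrite /cis mulr0 cos0 sin0. Qed.

Lemma cisN x : cis (- x) = (cis x)^*.
Proof. by rewrite /cis mulrN cosN sinN. Qed.

Lemma cnorm_cis x : cnorm (cis x) = 1.
Proof. by rewrite /cnorm/= cos2Dsin2 sqrtr1. Qed.

Lemma cis_neq0 x : cis x != 0.
Proof. by rewrite -cnorm_eq0 cnorm_cis oner_eq0. Qed.

Lemma cisMn x n : cis (n%:R * x) = cis x ^+ n.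
Proof.
elim: n => [|n IH]; first by rewrite mul0r cis0.
by rewrite -[in LHS]addn1 natrD mulrDl mul1r cisD IH exprSr.
Qed.

Lemma cis_1 : cis 1 = 1.
Proof. by rewrite /cis mulr1 mulrC mulr_natr cos2pi sin2pi. Qed.

Lemma cis_nat n : cis n%:R = 1.
Proof. by rewrite -(mulr1 n%:R) cisMn cis_1 expr1n. Qed.

Lemma cis_int (k : int) : cis k%:~R = 1.
Proof.
case: k => n; first exact: cis_nat.
by rewrite NegzE mulrNz cisN cis_nat conjc1.
Qed.

(** [cos] is injective on [0, pi] only; beyond pi the same argument applied to 2 pi - x would force
    x = 2 pi. *)
Lemma cos_eq1_lt2pi x : 0 <= x < pi *+ 2 -> cos x = 1 -> x = 0.
Proof.
move=> /andP[x0 x2] c1; have p0 := pi_gt0 R.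
have [xp|xp] := lerP x pi.
  by apply: cos_inj; rewrite ?in_itv/= ?x0 ?xp ?lexx ?ltW// cos0.
have : pi *+ 2 - x = 0.
  apply: cos_inj; rewrite ?in_itv/= ?lexx ?(ltW p0)//.
    by rewrite subr_ge0 (ltW x2)/= lerBlDr mulr2n lerD2l ltW.
  by rewrite cos0 -cosN opprB cosB cos2pi sin2pi mulr1 mulr0 addr0.
by move=> /eqP; rewrite subr_eq0 => /eqP xE; move: x2; rewrite xE ltxx.
Qed.

Lemma cis_eq1 x : cis x = 1 -> x = (Num.floor x)%:~R.
Proof.
move=> h; apply/eqP; rewrite -subr_eq0; apply/eqP.
set y := x - _; have : cis y = 1.
  by rewrite /y cisD h mul1r -mulrNz cis_int.
have /andP[f1 f2] := floor_itv x; have p0 := pi_gt0 R.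
move=> /(congr1 (@complex.Re R))/= /cos_eq1_lt2pi.
have y0 : 0 <= y by rewrite subr_ge0.
have y1 : y < 1 by move: f2; rewrite intrD ltrBlDl.
have -> : 0 <= 2 * pi * y < pi *+ 2.
  rewrite -[pi *+ 2]mulr_natl mulr_ge0 ?mulr_ge0 ?(ltW p0)//=.
  by rewrite -[ltRHS]mulr1 ltr_pM2l// mulr_gt0.
by move=> /(_ isT) /eqP; rewrite mulf_eq0 mulf_eq0 pnatr_eq0 (gt_eqF p0)/= => /eqP.
Qed.

End complex_exponential.

(** * Sequences with mean zero and Bernstein polynomials *)

Section mean_zero.
Context {R : realType}.
Implicit Types (f g : nat -> R[i]).

Definition mean_zero f := forall e : R, 0 < e ->
  \forall N \near \oo, cnorm (\sum_(n < N) f n) <= e * N%:R.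

Lemma near_le_muln (K e : R) : 0 < e -> \forall N \near \oo, K <= e * N%:R.
Proof.
move=> e0; near=> N.
rewrite mulrC -ler_pdivrMr//.
near: N; exact: nbhs_infty_ger.
Unshelve. all: by end_near. Qed.

Lemma mean_zero0 : mean_zero (fun=> 0).
Proof.
move=> e e0; near=> N; rewrite big1// cnorm0 mulr_ge0//.
exact: ltW.
Unshelve. all: by end_near. Qed.

Lemma mean_zeroD f g : mean_zero f -> mean_zero g ->
  mean_zero (fun n => f n + g n).
Proof.
move=> hf hg e e0; have e20 : 0 < e / 2 by rewrite divr_gt0.
near=> N; rewrite big_split/=; apply: (le_trans (cnormD _ _)).
rewrite (splitr e) mulrDl lerD//; near: N; [exact: hf|exact: hg].
Unshelve. all: by end_near. Qed.

Lemma mean_zeroZ c f : mean_zero f -> mean_zero (fun n => c * f n).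
Proof.
move=> hf e e0; have c0 : 0 < cnorm c + 1 by rewrite ltr_wpDl// cnorm_ge0.
near=> N; rewrite -mulr_sumr cnormM.
have h : cnorm (\sum_(n < N) f n) <= e / (cnorm c + 1) * N%:R.
  by near: N; apply: hf; rewrite divr_gt0.
apply: (le_trans (ler_wpM2l (cnorm_ge0 c) h)).
rewrite mulrA ler_wpM2r// mulrA ler_pdivrMr// [_ * e]mulrC ler_wpM2l ?(ltW e0)//.
by rewrite lerDl.
Unshelve. all: by end_near. Qed.

Lemma mean_zero_sum (I : Type) (s : seq I) (F : I -> nat -> R[i]) :
  (forall i, mean_zero (F i)) -> mean_zero (fun n => \sum_(i <- s) F i n).
Proof.
move=> h; elim: s => [|i s IH].
  by under eq_fun do rewrite big_nil; exact: mean_zero0.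
by under eq_fun do rewrite big_cons; exact: (mean_zeroD (h i) IH).
Qed.

(** Multiplied by z - 1, the sums telescope to z ^ N - 1, of modulus at most 2. *)
Lemma mean_zero_geom z : cnorm z = 1 -> z != 1 -> mean_zero (fun n => z ^+ n).
Proof.
move=> z1 zn1 e e0.
have d0 : 0 < cnorm (z - 1).
  by rewrite lt_neqAle cnorm_ge0 andbT eq_sym cnorm_eq0 subr_eq0.
near=> N.
have : cnorm ((z - 1) * \sum_(i < N) z ^+ i) <= 2.
  by rewrite -subrX1; apply: (le_trans (cnormB _ _)); rewrite cnormX z1 expr1n cnorm1.
rewrite cnormM mulrC -ler_pdivlMr// => h; apply: (le_trans h).
by near: N; exact: (near_le_muln (2 / cnorm (z - 1)) e0).
Unshelve. all: by end_near. Qed.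

(** Closeness is asked only on average, so a set of n of small density, where approximation fails,
    can be handled by a crude bound. *)
Lemma mean_zero_approx f : (forall e : R, 0 < e -> exists g, mean_zero g /\
    \forall N \near \oo, \sum_(n < N) cnorm (f n - g n) <= e * N%:R) ->
  mean_zero f.
Proof.
move=> h e e0; have e20 : 0 < e / 2 by rewrite divr_gt0.
have [g [hg fg]] := h _ e20.
near=> N.
rewrite (eq_bigr (fun n : 'I_N => (f n - g n) + g n)); last by move=> *; rewrite subrK.
rewrite big_split/=; apply: (le_trans (cnormD _ _)).
rewrite (splitr e) mulrDl lerD//; last by near: N; exact: hg.
by apply: (le_trans (cnorm_sum _ _ _)); near: N.
Unshelve. all: by end_near. Qed.

End mean_zero.

Section bernstein.
Context {R : realType}.
Implicit Types (g : nat -> R) (x : R).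

(* [bern n g] is the polynomial \sum_k 'C(n, k) (g k) X^k (1 - X)^(n - k): the
   mean of [g] under the binomial law, computed by conditioning on one trial. *)
Fixpoint bern n g : {poly R} :=
  if n is m.+1 then 'X * bern m (fun k => g k.+1) + (1 - 'X) * bern m g
  else (g 0%N)%:P.

Lemma bernS n g x :
  (bern n.+1 g).[x] = x * (bern n (fun k => g k.+1)).[x] + (1 - x) * (bern n g).[x].
Proof. by rewrite /= !hornerE. Qed.

Lemma bernD n g1 g2 x :
  (bern n (fun k => g1 k + g2 k)).[x] = (bern n g1).[x] + (bern n g2).[x].
Proof.
elim: n g1 g2 => [|n IH] g1 g2; first by rewrite /= !hornerC.
by rewrite !bernS !IH; ring.
Qed.

Lemma bernZ n c g x : (bern n (fun k => c * g k)).[x] = c * (bern n g).[x].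
Proof.
elim: n g => [|n IH] g; first by rewrite /= !hornerC.
by rewrite !bernS !IH; ring.
Qed.

Lemma bern_cst n c x : (bern n (fun=> c)).[x] = c.
Proof.
by elim: n => [|n IH]; [rewrite /= hornerC|rewrite bernS IH; ring].
Qed.

Lemma bern_id n x : (bern n (fun k => k%:R)).[x] = n%:R * x.
Proof.
elim: n => [|n IH]; first by rewrite /= hornerC mul0r.
rewrite bernS; under [X in bern n X]eq_fun do rewrite -natr1.
by rewrite bernD IH bern_cst -natr1; ring.
Qed.

Lemma bern_sqr n x :
  (bern n (fun k => k%:R ^+ 2)).[x] = (n%:R * x) ^+ 2 + n%:R * (x * (1 - x)).
Proof.
elim: n => [|n IH]; first by rewrite /= hornerC !mul0r expr0n addr0.
rewrite bernS.
rewrite (_ : (fun k => _) = (fun k => k%:R ^+ 2 + (2 * k%:R + 1))); last first.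
  by apply/funext => k; rewrite -natr1; ring.
by rewrite bernD bernD bernZ IH bern_id bern_cst -natr1; ring.
Qed.

Lemma bern_le n g1 g2 x : 0 <= x <= 1 -> (forall k, (k <= n)%N -> g1 k <= g2 k) ->
  (bern n g1).[x] <= (bern n g2).[x].
Proof.
move=> /andP[x0 x1]; elim: n g1 g2 => [|n IH] g1 g2 h; first by rewrite /= !hornerC h.
rewrite !bernS lerD// ler_wpM2l// ?subr_ge0//; apply: IH => k kn; apply: h => //.
by rewrite ltnW.
Qed.

(** The error is at most the binomial mean of K |x - k/m|. AM-GM replaces the absolute value by a
    quadratic in k, whose mean follows exactly from the moments of order 0, 1 and 2. *)
Lemma bernstein_approx (f : R -> R) (K : R) : 0 <= K ->
  (forall x y, 0 <= x <= 1 -> 0 <= y <= 1 -> `|f x - f y| <= K * `|x - y|) ->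
  forall e, 0 < e -> exists p : {poly R}, forall x, 0 <= x <= 1 -> `|f x - p.[x]| <= e.
Proof.
move=> K0 fK e e0.
pose d : R := e / (K + 1).
have K1 : 0 < K + 1 by rewrite ltr_wpDl.
have d0 : 0 < d by rewrite divr_gt0.
(* With m d^2 > 1 the variance x (1 - x) / m of k/m is below d^2, and the mean of the quadratic is
   at most K d <= e. *)
have [m mR] : exists m, 1 / d ^+ 2 < m%:R.
  by exists (Num.trunc (1 / d ^+ 2)).+1; exact: truncnS_gt.
have m0 : 0 < m%:R :> R by apply: le_lt_trans mR; rewrite divr_ge0 ?sqr_ge0.
exists (bern m (fun k => f (k%:R / m%:R))) => x x01.
have /andP[x0 x1] := x01.
(* AM-GM: |a| <= (d + a^2 / d) / 2 *)
have amgm (a : R) : `|a| <= (d + a ^+ 2 / d) / 2.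
  rewrite ler_pdivlMr// -(ler_pM2r d0) mulrDl divfK ?gt_eqF//.
  rewrite -[a ^+ 2]real_normK ?num_real//.
  rewrite -subr_ge0 (_ : _ - _ = (d - `|a|) ^+ 2); first exact: sqr_ge0.
  by ring.
have key : (bern m (fun k => K * ((d + (k%:R / m%:R - x) ^+ 2 / d) / 2))).[x] <= e.
  rewrite (_ : (fun k => _) = (fun k => K * (d + x ^+ 2 / d) / 2 +
     (K / (2 * d * m%:R ^+ 2) * k%:R ^+ 2 + (- K * x / (d * m%:R)) * k%:R))); last first.
    by apply/funext => k; field; rewrite !gt_eqF.
  rewrite bernD bernD !bernZ bern_id bern_sqr bern_cst.
  rewrite [leLHS](_ : _ = K * (d / 2 + x * (1 - x) / (2 * d * m%:R))); last first.
    by field; rewrite !gt_eqF.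
  have h1 : x * (1 - x) / (2 * d * m%:R) <= d / 2.
    rewrite ler_pdivrMr; last by apply: mulr_gt0 => //; apply: mulr_gt0.
    have h2 : 1 <= d ^+ 2 * m%:R.
      by rewrite mulrC -ler_pdivrMr ?exprn_gt0// ltW.
    apply: (@le_trans _ _ 1); first nra.
    by apply: (le_trans h2); rewrite le_eqVlt; apply/orP; left; apply/eqP; field.
  apply: (@le_trans _ _ (K * d)).
    by rewrite ler_wpM2l//; lra.
  by rewrite /d mulrCA -[leRHS]mulr1 ler_wpM2l ?(ltW e0)// ler_pdivrMr// mul1r lerDl.
have hk k : (k <= m)%N -> `|f x - f (k%:R / m%:R)| <=
    K * ((d + (k%:R / m%:R - x) ^+ 2 / d) / 2).
  move=> km; apply: (le_trans (fK _ _ x01 _)).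
    by rewrite divr_ge0//= ler_pdivrMr// mul1r ler_nat.
  by rewrite ler_wpM2l// distrC.
rewrite ler_norml; apply/andP; split.
  rewrite lerBrDl lerBlDr -[X in _ <= _ + X]/(e) -(bern_cst m (f x) x).
  apply: (@le_trans _ _ ((bern m (fun=> f x)).[x] +
     (bern m (fun k => K * ((d + (k%:R / m%:R - x) ^+ 2 / d) / 2))).[x])); last first.
    by rewrite bern_cst lerD2l.
  rewrite -bernD; apply: bern_le => // k km.
  have := hk k km; rewrite ler_norml => /andP[+ _]; lra.
rewrite lerBlDr -{1}(bern_cst m (f x) x) addrC.
apply: (@le_trans _ _ ((bern m (fun k => f (k%:R / m%:R))).[x] +
     (bern m (fun k => K * ((d + (k%:R / m%:R - x) ^+ 2 / d) / 2))).[x])); last first.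
  by rewrite lerD2l.
rewrite -bernD; apply: bern_le => // k km.
have := hk k km; rewrite ler_norml => /andP[_]; lra.
Qed.

End bernstein.

(** * Weyl's criterion *)

Section weyl.
Context {R : realType}.
Variable y : nat -> R.
Hypothesis y_mean_zero :
  forall h : nat, (0 < h)%N -> mean_zero (fun n => cis (h%:R * y n)).

Lemma mean_zero_conj (f : nat -> R[i]) : mean_zero f -> mean_zero (fun n => (f n)^*).
Proof.
move=> h e /h; apply: filterS => N.
by rewrite -rmorph_sum cnorm_conj.
Qed.

(* Comparing means along [y] with means on fine grids replaces the integral of [F]
   over the circle by a count of grid points. *)
Definition grid_mean (F : R -> R[i]) := exists m,
  (forall s, mean_zero (fun n => F (y n - s) - m)) /\
  exists K : nat, forall k, (K < k)%N -> \sum_(i < k) F (i%:R / k%:R) = k%:R * m.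

Lemma grid_mean_lin a F G : grid_mean F -> grid_mean G ->
  grid_mean (fun v => a * F v + G v).
Proof.
move=> [m [hm [K hK]]] [m' [hm' [K' hK']]]; exists (a * m + m'); split.
  move=> s; under eq_fun do rewrite opprD addrACA -mulrBr.
  exact: (mean_zeroD (mean_zeroZ a (hm s)) (hm' s)).
exists (maxn K K') => k; rewrite gtn_max => /andP[k1 k2].
by rewrite big_split/= -mulr_sumr hK// hK'// mulrDr mulrCA.
Qed.

(** For h <> 0, the mean along [y] is the hypothesis, up to conjugation when h < 0 and a constant
    factor from the shift. The sum over k grid points is geometric of ratio exp(2 i pi h / k), which
    differs from 1 once k > |h|. *)
Lemma grid_mean_cis (h : int) : grid_mean (fun v => cis (h%:~R * v)).
Proof.
have [->|h0] := eqVneq h 0.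
  exists 1; split.
    move=> s; under eq_fun do rewrite mul0r cis0 subrr; exact: mean_zero0.
  exists 0%N => k k0; under eq_bigr do rewrite mul0r cis0.
  by rewrite sumr_const card_ord mulr1.
exists 0; split.
  move=> s; under eq_fun do rewrite subr0 mulrBr cisD mulrC.
  apply: (@mean_zeroZ _ (cis (- (h%:~R * s))) (fun n => cis (h%:~R * y n))).
  case: h h0 => n n0; first by apply: (@y_mean_zero n); lia.
  rewrite NegzE; under eq_fun do rewrite mulrNz mulNr cisN.
  exact: (mean_zero_conj (y_mean_zero (ltn0Sn n))).
exists `|h|%N => k hk; rewrite mulr0.
have k0 : k%:R != 0 :> R by rewrite pnatr_eq0; lia.
under eq_bigr => i _.
  rewrite (_ : h%:~R * _ = i%:R * (h%:~R / k%:R)); last by field.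
  rewrite cisMn; over.
set z := cis _.
have z1 : z - 1 != 0.
  rewrite subr_eq0; apply/eqP => /cis_eq1; set j := Num.floor _ => E.
  have {}E : h%:~R = (k%:Z * j)%:~R :> R.
    by rewrite intrM -E; field.
  move/eqP: E; rewrite eqr_int => /eqP E; move: hk h0; rewrite E abszM absz_nat.
  have [->|j0] := eqVneq j 0; first by rewrite mulr0 eqxx.
  by rewrite ltnNge leq_pmulr// absz_gt0.
apply: (mulfI z1); rewrite -subrX1 mulr0 -cisMn mulrC divfK//.
by rewrite cis_int subrr.
Qed.

(** [cos] is the half sum of [cis] and its conjugate, so a factor cos shifts the frequency by 1 both
    ways; hence the induction over all [h]. *)
Lemma grid_mean_cos j (h : int) :
  grid_mean (fun v => (cos (2 * pi * v))%:C ^+ j * cis (h%:~R * v)).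
Proof.
elim: j h => [|j IH] h.
  by under eq_fun do rewrite expr0 mul1r; exact: grid_mean_cis.
rewrite (_ : (fun v => _) = (fun v =>
    2^-1 * ((cos (2 * pi * v))%:C ^+ j * cis ((h + 1)%:~R * v)) +
    (2^-1 * ((cos (2 * pi * v))%:C ^+ j * cis ((h - 1)%:~R * v)) + 0))).
  apply: grid_mean_lin; first exact: IH.
  apply: grid_mean_lin; first exact: IH.
  exists 0; split; first by move=> s; under eq_fun do rewrite subrr; exact: mean_zero0.
  by exists 0%N => k _; rewrite mulr0 big1.
apply/funext => v.
have -> : cis ((h + 1)%:~R * v) = cis (h%:~R * v) * cis v.
  by rewrite intrD mulrDl mul1r cisD.
have -> : cis ((h - 1)%:~R * v) = cis (h%:~R * v) * (cis v)^*.
  by rewrite intrD mulrDl mulN1r cisD cisN.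
rewrite exprS.
have -> : (cos (2 * pi * v))%:C = 2^-1 * (cis v + (cis v)^*).
  by rewrite addcJ mulrA mulVf ?mul1r// pnatr_eq0.
by field.
Qed.

Lemma grid_mean_poly (p : {poly R}) : grid_mean (fun v => (p.[cos (2 * pi * v)])%:C).
Proof.
rewrite (_ : (fun v => _) =
    (fun v => \sum_(i < size p) (p`_i)%:C * (cos (2 * pi * v))%:C ^+ i)); last first.
  apply/funext => v; rewrite horner_coef rmorph_sum/=; apply: eq_bigr => i _.
  by rewrite rmorphM/= rmorphXn.
elim: (size p) => [|k IH].
  under eq_fun do rewrite big_ord0.
  exists 0; split; first by move=> s; under eq_fun do rewrite subrr; exact: mean_zero0.
  by exists 0%N => k _; rewrite mulr0 big1.
under eq_fun do rewrite big_ord_recr/= addrC.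
apply: grid_mean_lin IH; have := grid_mean_cos k 0.
by under eq_fun do rewrite mul0r cis0 mulr1.
Qed.

Lemma sum_le_nat (k : nat) (t : R) : 0 <= t ->
  \sum_(i < k) (i%:R <= t)%R%:R <= t + 1 :> R.
Proof.
(* The bound by k carries the induction as long as k <= t. *)
move=> t0; suff : \sum_(i < k) (i%:R <= t)%R%:R <= t + 1 :> R /\
    \sum_(i < k) (i%:R <= t)%R%:R <= k%:R :> R by case.
elim: k => [|k [IH1 IH2]]; first by rewrite big_ord0 addr_ge0.
rewrite big_ord_recr/= -natr1; by case: (lerP k%:R t) => kt /=; split; lra.
Qed.

Lemma cos_lt_pi (u v : R) : 0 <= v <= pi -> `|u| <= v -> cos v <= cos u.
Proof.
move=> /andP[v0 vp] uv; rewrite -(cos_norm u).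
have [->//|uv'] := eqVneq `|u| v.
apply/ltW; rewrite ltr_cos ?in_itv/= ?v0 ?vp ?normr_ge0 ?(le_trans uv)//.
by rewrite lt_neqAle uv'.
Qed.

(** Substitute for the indicator of a half-line, affine from 0 at [a] to 1 at [b]: Bernstein
    approximation requires a Lipschitz function. *)
Definition ramp (a b c : R) : R := Num.max 0 (Num.min 1 ((c - a) / (b - a))).

Lemma ramp_le a b c : a < b -> ramp a b c <= (a <= c)%R%:R.
Proof.
move=> ab; rewrite /ramp; case: (lerP a c) => ac /=; rewrite ge_max ?ler01 ?lexx/=.
  by rewrite ge_min lexx.
by rewrite ge_min pmulr_lle0 ?invr_gt0 ?subr_gt0// subr_le0 (ltW ac) orbT.
Qed.

Lemma ramp_ge a b c : a < b -> (b <= c)%R%:R <= ramp a b c.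
Proof.
move=> ab; rewrite /ramp le_max; case: (lerP b c) => bc /=; rewrite ?lexx//.
by rewrite le_min lexx ler_pdivlMr ?subr_gt0// mul1r lerD2r bc orbT.
Qed.

Lemma maxr_lip (a b c : R) : `|Num.max a b - Num.max a c| <= `|b - c|.
Proof.
by case: (lerP a b); case: (lerP a c) => h1 h2; rewrite ?subrr ?normr0 ?normr_ge0//;
  rewrite ler_norml; apply/andP; split; have := ler_norm (b - c);
  have := ler_norm (c - b); rewrite distrC; lra.
Qed.

Lemma minr_lip (a b c : R) : `|Num.min a b - Num.min a c| <= `|b - c|.
Proof.
have -> : b - c = - c - - b by lra.
have h u : Num.min a u = - Num.max (- a) (- u) by rewrite oppr_max !opprK.
rewrite !h [X in `|X|](_ : _ = Num.max (- a) (- c) - Num.max (- a) (- b)); last lra.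
exact: maxr_lip.
Qed.

Lemma ramp_lip a b c c' : a < b -> `|ramp a b c - ramp a b c'| <= (b - a)^-1 * `|c - c'|.
Proof.
move=> ab; apply: (le_trans (maxr_lip _ _ _)); apply: (le_trans (minr_lip _ _ _)).
rewrite -mulrBl opprB addrA subrK normrM mulrC ler_wpM2r//.
by rewrite ger0_norm// invr_ge0 subr_ge0 ltW.
Qed.

End weyl.

Section weyl_criterion.
Context {R : realType}.
Variable y : nat -> R.
Hypothesis y_mean_zero :
  forall h : nat, (0 < h)%N -> mean_zero (fun n => cis (h%:R * y n)).

Lemma cos_outside_arc (a u : R) : 0 <= a -> a < u < pi *+ 2 - a -> cos u < cos a.
Proof.
move=> a0 /andP[au ua]; have [up|up] := lerP u pi.
  by rewrite ltr_cos// in_itv/= ?a0 ?up ?andbT; lra.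
rewrite -(cosN u) -cosD2pi addrC ltr_cos; first lra.
  by rewrite in_itv/=; apply/andP; split; lra.
by rewrite in_itv/=; apply/andP; split; lra.
Qed.

(** The cosine inequality confines i to the two ends of the grid; with t = k l / 2, each end
    contributes at most t + 1 indices. *)
Lemma grid_arc_count (k : nat) (l : R) : 0 <= l < 1 ->
  \sum_(i < k) (cos (pi * l) <= cos (2 * pi * (i%:R / k%:R)))%R%:R <= k%:R * l + 2.
Proof.
move=> /andP[l0 l1]; have p0 := pi_gt0 R; set t := k%:R * l / 2.
have t0 : 0 <= t by rewrite divr_ge0// mulr_ge0.
have -> : k%:R * l + 2 = (t + 1) + (t + 1) by rewrite /t; field.
apply: (@le_trans _ _ (\sum_(i < k) ((i%:R <= t)%R%:R + ((rev_ord i)%:R <= t)%R%:R))); last first.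
  rewrite big_split/= lerD ?sum_le_nat//.
  rewrite (reindex_inj rev_ord_inj)/= (eq_bigr (fun i : 'I_k => (i%:R <= t)%R%:R)) ?sum_le_nat//.
  by move=> i _; rewrite (_ : (k - (k - i.+1).+1)%N = i)//; have := ltn_ord i; lia.
have b1 (b : bool) : b%:R <= 1 :> R by case: b.
apply: ler_sum => i _; have ik := ltn_ord i.
have k0 : 0 < k%:R :> R by rewrite ltr0n; lia.
case: (lerP i%:R t) => it /=; first by apply: (le_trans (b1 _)); rewrite lerDl.
case: (lerP (rev_ord i)%:R t) => rt; first by apply: (le_trans (b1 _)); rewrite lerDr.
suff h : cos (2 * pi * (i%:R / k%:R)) < cos (pi * l).
  by rewrite (lt_geF h) addr_ge0.
apply: cos_outside_arc; first by rewrite mulr_ge0// ltW.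
move: rt; rewrite /= natrB// -natr1 => rt.
set v := i%:R / k%:R.
have iE : i%:R = k%:R * v by rewrite /v; field; rewrite gt_eqF.
move: it rt; rewrite iE /t => it rt.
have h1 : l / 2 < v by rewrite -(ltr_pM2l k0); lra.
have h2 : v < 1 - l / 2 by rewrite -(ltr_pM2l k0); lra.
by apply/andP; split; nra.
Qed.

(** The cosine condition says that [y n] lies modulo 1 in the closed arc of length l centred at s, a
    form that polynomials in cos can majorise. Lower bounds will come from the complementary arc. *)
Lemma weyl_upper (s l e : R) : 0 <= l < 1 -> 0 < e -> \forall N \near \oo,
  \sum_(n < N) (cos (pi * l) <= cos (2 * pi * (y n - s)))%R%:R <= (l + e) * N%:R.
Proof.
move=> /andP[l0 l1] e0; have p0 := pi_gt0 R.
(* Five errors of size d: widening l to l', polynomial approximation on the grid and along [y], the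
   excess 2/k of the grid count, and convergence of the means along [y]. *)
pose d : R := e / 5; have d0 : 0 < d by rewrite divr_gt0.
pose l' := Num.min ((1 + l) / 2) (l + d).
have ll' : l < l' by rewrite lt_min; apply/andP; split; lra.
have l'1 : l' < 1 by rewrite gt_min; apply/orP; left; lra.
have l'd : l' <= l + d by rewrite ge_min lexx orbT.
set b := cos (pi * l); pose a := cos (pi * l').
have ab : a < b.
  by rewrite /a /b ltr_cos ?in_itv/= ?ltr_pM2l//; apply/andP; split; nra.
have [q hq] : exists q : {poly R}, forall x, 0 <= x <= 1 ->
    `|ramp a b (2 * x - 1) - q.[x]| <= d.
  apply: (@bernstein_approx _ (fun x => ramp a b (2 * x - 1)) (2 / (b - a))) => //.
    by rewrite divr_ge0// subr_ge0 ltW.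
  move=> x z _ _; apply: (le_trans (ramp_lip _ _ ab)).
  rewrite (_ : 2 * x - 1 - (2 * z - 1) = 2 * (x - z)); last by ring.
  by rewrite normrM ger0_norm// mulrA [_^-1 * 2]mulrC.
pose P := q \Po (2^-1 *: ('X + 1)).
have hP v : `|ramp a b (cos v) - P.[cos v]| <= d.
  have -> : P.[cos v] = q.[2^-1 * (cos v + 1)] by rewrite horner_comp !hornerE.
  have {1}-> : cos v = 2 * (2^-1 * (cos v + 1)) - 1 by field.
  by apply: hq; apply/andP; have := cos_geN1 v; have := cos_le1 v; split; lra.
have [m [hm [K hK]]] := grid_mean_poly y_mean_zero P.
pose k := (maxn K (Num.trunc (2 / d))).+1.
have kK : (K < k)%N by rewrite /k ltnS leq_maxl.
have kd : 2 <= d * k%:R.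
  rewrite mulrC -ler_pdivrMr// (le_trans (ltW (truncnS_gt _)))// ler_nat.
  by rewrite /k ltnS leq_maxr.
move: k kK kd => k kK kd.
have k0 : 0 < k%:R :> R by rewrite ltr0n (leq_ltn_trans _ kK).
pose M := k%:R^-1 * \sum_(i < k) P.[cos (2 * pi * (i%:R / k%:R))].
have mM : m = M%:C.
  have := hK _ kK; rewrite -rmorph_sum/= => /(congr1 (fun z => (k%:R)^-1 * z)).
  rewrite mulrA mulVf ?mul1r; last by rewrite pnatr_eq0 -lt0n (leq_ltn_trans _ kK).
  by move=> <-; rewrite /M rmorphM/= fmorphV/= rmorph_nat.
have Mle : M <= l + 3 * d.
  rewrite /M ler_pdivrMl//.
  apply: (@le_trans _ _ (\sum_(i < k)
      ((cos (pi * l') <= cos (2 * pi * (i%:R / k%:R)))%R%:R + d))).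
    apply: ler_sum => i _; have := hP (2 * pi * (i%:R / k%:R)).
    rewrite ler_norml => /andP[h1 h2].
    have := @ramp_le _ a b (cos (2 * pi * (i%:R / k%:R))) ab.
    rewrite -/a; lra.
  rewrite big_split/= sumr_const card_ord -[d *+ k]mulr_natl.
  have : \sum_(i < k) (cos (pi * l') <= cos (2 * pi * (i%:R / k%:R)))%R%:R <= k%:R * l' + 2.
    by apply: grid_arc_count; apply/andP; split; lra.
  have : k%:R * l' <= k%:R * (l + d) by rewrite ler_wpM2l// ltW.
  lra.
near=> N.
have hN : cnorm (\sum_(n < N) ((P.[cos (2 * pi * (y n - s))])%:C - m)) <= d * N%:R.
  by near: N; exact: hm.
move: hN; rewrite mM; under eq_bigr do rewrite -rmorphB.
rewrite -rmorph_sum -[X in cnorm X]/((_)%:C) cnormR sumrB sumr_const card_ord -[M *+ N]mulr_natl => /(le_trans (ler_norm _)) hN.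
apply: (@le_trans _ _ (\sum_(n < N) (P.[cos (2 * pi * (y n - s))] + d))).
  apply: ler_sum => n _; have := hP (2 * pi * (y n - s)).
  rewrite ler_norml => /andP[h1 h2].
  by apply: (le_trans (ramp_ge _ ab)); lra.
rewrite big_split/= sumr_const card_ord -[d *+ N]mulr_natl.
have N0 : 0 <= N%:R :> R by [].
have -> : e = 5 * d by rewrite /d; field.
have : N%:R * M <= N%:R * (l + 3 * d) by rewrite ler_wpM2l.
lra.
Unshelve. all: by end_near. Qed.

Lemma cos_frac (v s : R) :
  cos (2 * pi * (v - s)) = cos (2 * pi * (v - (Num.floor v)%:~R - s)).
Proof.
have -> : v - s = (Num.floor v)%:~R + (v - (Num.floor v)%:~R - s) by ring.
have := congr1 (@complex.Re R) (cisD (Num.floor v)%:~R (v - (Num.floor v)%:~R - s)).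
rewrite cis_int mul1r /= => ->; congr cos; congr (_ * _); ring.
Qed.

(** Fractional parts in [0, l] lie in the arc of length l around l/2, the others in the arc of
    length 1 - l around (1 + l)/2, so two upper bounds squeeze the count. For l = 0 the second arc
    would be the whole circle, outside the range of [weyl_upper], but the lower bound is then
    trivial. *)
Lemma weyl_cvg (l e : R) (N : nat) : 0 <= l < 1 -> 0 < e -> (0 < N)%N ->
  \sum_(n < N) (cos (pi * l) <= cos (2 * pi * (y n - l / 2)))%R%:R <= (l + e) * N%:R ->
  l = 0 \/ \sum_(n < N) (cos (pi * (1 - l)) <= cos (2 * pi * (y n - (1 + l) / 2)))%R%:R
      <= (1 - l + e) * N%:R ->
  `|l - (\sum_(n < N) ((y n - (Num.floor (y n))%:~R <= l)%R%:R : R)) / N%:R| <= e.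
Proof.
move=> /andP[l0 l1] e0 N_gt0 up low; have p0 := pi_gt0 R.
have N0 : 0 < N%:R :> R by rewrite ltr0n.
have frac n : 0 <= y n - (Num.floor (y n))%:~R < 1.
  have /andP[f1 f2] := floor_itv (y n).
  by rewrite subr_ge0 f1/= ltrBlDl -[1]/(1%:~R) -intrD.
set S := \sum_(n < N) _.
have hu : S <= (l + e) * N%:R.
  apply: le_trans up.
  apply: ler_sum => n _; case: (lerP (y n - _) l) => [hn|_ //].
  suff h : cos (pi * l) <= cos (2 * pi * (y n - l / 2)) by rewrite h.
  have /andP[f1 f2] := frac n.
  rewrite cos_frac; apply: cos_lt_pi; first by apply/andP; split; nra.
  rewrite normrM ger0_norm; last by nra.
  suff : `|y n - (Num.floor (y n))%:~R - l / 2| <= l / 2 by nra.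
  by rewrite ler_norml; apply/andP; split; lra.
have hl : (l - e) * N%:R <= S.
  case: low => [->|low].
    by apply: (@le_trans _ _ 0); [rewrite sub0r mulNr oppr_le0 mulr_ge0 ?(ltW e0) ?(ltW N0)|rewrite sumr_ge0].
  suff : N%:R <= S + \sum_(n < N) (cos (pi * (1 - l)) <= cos (2 * pi * (y n - (1 + l) / 2)))%R%:R.
    by lra.
  rewrite /S -big_split/= -{1}(card_ord N) -sum1_card natr_sum; apply: ler_sum => n _.
  case: (lerP (y n - _) l) => [_|hn]; first by rewrite lerDl.
  suff h : cos (pi * (1 - l)) <= cos (2 * pi * (y n - (1 + l) / 2)).
    by rewrite h add0r.
  have /andP[f1 f2] := frac n.
  rewrite cos_frac; apply: cos_lt_pi; first by apply/andP; split; nra.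
  rewrite normrM ger0_norm; last by nra.
  suff : `|y n - (Num.floor (y n))%:~R - (1 + l) / 2| <= (1 - l) / 2 by nra.
  by rewrite ler_norml; apply/andP; split; lra.
have su : S / N%:R <= l + e by rewrite ler_pdivrMr.
have sl : l - e <= S / N%:R by rewrite ler_pdivlMr.
by rewrite ler_norml; apply/andP; split; lra.
Qed.

Lemma weyl_criterion (l : R) : 0 <= l < 1 ->
  (\sum_(n < N) ((y n - (Num.floor (y n))%:~R <= l)%R%:R : R)) / N%:R @[N --> \oo] --> l.
Proof.
move=> /andP[l0 l1]; have l01 : 0 <= l < 1 by rewrite l0.
apply/cvgrPdist_le => e e0.
have low : l != 0 -> \forall N \near \oo, \sum_(n < N)
    (cos (pi * (1 - l)) <= cos (2 * pi * (y n - (1 + l) / 2)))%R%:R <= (1 - l + e) * N%:R.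
  move=> l_neq0; apply: weyl_upper => //; apply/andP; split; first lra.
  by rewrite ltrBlDr ltrDl lt_neqAle eq_sym l_neq0.
have [l_eq0|/low {}low] := eqVneq l 0; near=> N.
  apply: weyl_cvg => //; first by near: N; exact: nbhs_infty_gt.
  - by near: N; apply: weyl_upper => //; apply/andP.
  - by left.
apply: weyl_cvg => //; first by near: N; exact: nbhs_infty_gt.
- by near: N; apply: weyl_upper => //; apply/andP.
- by right; near: N.
Unshelve. all: by end_near. Qed.

End weyl_criterion.

(** * Sums of geometric sequences *)

Section small_values.
Context {R : realType}.

Lemma isolated_count_mul (F : pred nat) (K q : nat) :
  (forall n a, (0 < a <= K)%N -> F n -> ~~ F (n + a)%N) ->
  (\sum_(i < q * K.+1) F i <= q)%N.
Proof.
move=> hF.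
(* A window of at most K + 1 consecutive integers holds at most one point of F. *)
have win j n : (j <= K.+1)%N -> (\sum_(i < j) F (n + i)%N <= 1)%N.
  elim: j n => [|j IH] n jK; first by rewrite big_ord0.
  rewrite big_ord_recl addn0; case: (boolP (F n)) => Fn.
    rewrite big1// => i _; apply/eqP; rewrite eqb0 hF//= /bump/=.
    by have := ltn_ord i; lia.
  rewrite add0n; under eq_bigr do rewrite /= /bump /= add1n addnS -addSn.
  by apply: IH; rewrite ltnW.
elim: q => [|q IH]; first by rewrite mul0n big_ord0.
rewrite mulSnr big_split_ord/=.
by apply: (leq_trans (leq_add IH (win K.+1 _ (leqnn _)))); rewrite addn1.
Qed.

Lemma isolated_count (F : pred nat) (K N : nat) :
  (forall n a, (0 < a <= K)%N -> F n -> ~~ F (n + a)%N) ->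
  \sum_(i < N) (F i)%:R <= N%:R / K.+1%:R + 1 :> R.
Proof.
move=> hF; rewrite -natr_sum.
have h : (\sum_(i < N) F i <= (N %/ K.+1).+1)%N.
  apply: leq_trans (isolated_count_mul (N %/ K.+1).+1 hF).
  have le : (N <= (N %/ K.+1).+1 * K.+1)%N by rewrite ltnW// ltn_ceil.
  by rewrite -(subnKC le) big_split_ord/= leq_addr.
apply: (@le_trans _ _ (N %/ K.+1).+1%:R); first by rewrite ler_nat.
by rewrite -natr1 lerD2r ler_pdivlMr// -natrM ler_nat leq_trunc_div.
Qed.

Definition expsum (s : seq (R[i] * R[i])) n : R[i] := \sum_(p <- s) p.1 * p.2 ^+ n.

(* Write [w0] for the base of the first term.  The combination
   [expsum s (n + a) - w0 ^+ a * expsum s n] has one term less and is small when both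
   [n] and [n + a] give small values; a dense set of such [n] has many close pairs. *)
Lemma expsum_small_density s : s != [::] ->
  (forall p, p \in s -> p.1 != 0 /\ cnorm p.2 = 1) ->
  uniq (map snd s) ->
  (forall p q k, p \in s -> q \in s -> (0 < k)%N -> p.2 ^+ k = q.2 ^+ k -> p.2 = q.2) ->
  forall d : R, 0 < d -> exists2 e : R, 0 < e & \forall N \near \oo,
    \sum_(n < N) (cnorm (expsum s n) < e)%R%:R <= d * N%:R.
Proof.
have [m] := ubnP (size s); elim: m s => // m IH [//|[c0 w0] s] sm _ hs us ratio d d0.
have [s0|sn0] := eqVneq s [::].
  have [/= c00 w01] := hs (c0, w0) (mem_head _ _).
  exists (cnorm c0); first by rewrite lt_neqAle cnorm_ge0 andbT eq_sym cnorm_eq0.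
  near=> N; rewrite big1 ?mulr_ge0 ?(ltW d0)// => n _.
  by rewrite /expsum s0 big_seq1/= cnormM cnormX w01 expr1n mulr1 ltxx.
(* Isolated small values will have density at most 1 / (K + 1) < d / 3. *)
have [K K0] : exists K : nat, 3 / d < K.+1%:R.
  by exists (Num.trunc (3 / d)); exact: truncnS_gt.
(* The terms of the combination: base w0 has cancelled, and for a > 0 the other coefficients stay
   nonzero by the hypothesis on ratios. *)
pose v (a : nat) := [seq (p.1 * (p.2 ^+ a - w0 ^+ a), p.2) | p <- s].
have vE a n : expsum (v a) n = expsum ((c0, w0) :: s) (n + a) - w0 ^+ a * expsum ((c0, w0) :: s) n.
  rewrite /expsum !big_cons/= big_map mulrDr opprD addrACA.
  rewrite (_ : c0 * _ - _ = 0) ?add0r; last by rewrite exprD; ring.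
  rewrite mulr_sumr -sumrB; apply: eq_bigr => p _ /=.
  by rewrite exprD; ring.
have hd' : 0 < d / (3 * K.+1%:R) by rewrite divr_gt0// mulr_gt0.
have hv (a : 'I_K) : exists e, 0 < e /\ \forall N \near \oo,
    \sum_(n < N) (cnorm (expsum (v a.+1) n) < e)%R%:R <= d / (3 * K.+1%:R) * N%:R.
  have [e e0 he] : exists2 e : R, 0 < e & \forall N \near \oo,
      \sum_(n < N) (cnorm (expsum (v a.+1) n) < e)%R%:R <= d / (3 * K.+1%:R) * N%:R.
    have w0_neq p : p \in s -> p.2 != w0.
      move=> ps; apply/eqP => pw; move: us => /= /andP[+ _]; rewrite -pw => /negP; apply.
      by apply/mapP; exists p.
    have vs : v a.+1 = [seq (p.1 * (p.2 ^+ a.+1 - w0 ^+ a.+1), p.2) | p <- s] by [].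
    have mv p : p \in v a.+1 -> exists2 q, q \in s &
        p = (q.1 * (q.2 ^+ a.+1 - w0 ^+ a.+1), q.2).
      by rewrite vs => /mapP[q qs ->]; exists q.
    apply: IH => //.
    - by rewrite vs size_map.
    - by rewrite vs; case: (s) sn0.
    - move=> p /mv[q qs ->] /=; have [|q0 q1] := hs q; first by rewrite inE qs orbT.
      split=> //; rewrite mulf_neq0// subr_eq0; apply/eqP => h.
      have : q.2 = (c0, w0).2.
        by apply: (ratio q (c0, w0) a.+1) => //; rewrite ?mem_head// inE qs orbT.
      by move/eqP; rewrite (negbTE (w0_neq _ qs)).
    - by rewrite vs -map_comp; move: us => /= /andP[].
    - move=> p q k /mv[p' p's ->] /mv[q' q's ->] /=; apply: ratio.
        by rewrite inE p's orbT.
      by rewrite inE q's orbT.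
  by exists e.
have {hv} /choice[eps heps] := hv.
(* Halved, since two values below e must add up to less than [eps a]. *)
pose e := \big[Num.min/1]_a (eps a / 2).
have e0 : 0 < e.
  by rewrite lt_bigmin// => a _; have [? _] := heps a; rewrite divr_gt0.
exists e => //.
pose E n := cnorm (expsum ((c0, w0) :: s) n) < e.
(* Small values followed by K values that are not small, hence isolated. Any other small n makes
   [expsum (v a.+1) n] small for some a; by induction this costs density d / (3 (K + 1)) for each
   a. *)
pose F n := E n && [forall a : 'I_K, ~~ E (n + a.+1)%N].
have iso N : \sum_(i < N) (F i)%:R <= N%:R / K.+1%:R + 1 :> R.
  apply: isolated_count => n a aK /andP[_ /forallP h]; rewrite /F negb_and; apply/orP; left.
  have /andP[a_gt0 a_le] := aK; have aK' : (a.-1 < K)%N by rewrite prednK.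
  by have := h (Ordinal aK'); rewrite [nat_of_ord _]/= prednK.
have w01 : cnorm w0 = 1 by have [_ /=] := hs (c0, w0) (mem_head _ _).
have key n : (E n)%:R <= \sum_(a < K) (cnorm (expsum (v a.+1) n) < eps a)%R%:R + (F n)%:R :> R.
  case: (boolP (E n)) => En; last by rewrite addr_ge0// sumr_ge0.
  case: (boolP (F n)) => Fn; first by rewrite lerDr sumr_ge0.
  move: Fn; rewrite /F En/= negb_forall => /existsP[a]; rewrite negbK => Ena.
  rewrite (bigD1 a)//= -addrA; apply: (@le_trans _ _ 1) => //.
  suff -> : cnorm (expsum (v a.+1) n) < eps a by rewrite lerDl addr_ge0// sumr_ge0.
  rewrite vE; apply: (le_lt_trans (cnormB _ _)).
  rewrite cnormM cnormX w01 expr1n mul1r.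
  have : e <= eps a / 2 by exact: bigmin_le.
  by move: En Ena; rewrite /E; lra.
near=> N.
apply: (@le_trans _ _ (\sum_(n < N) (\sum_(a < K) (cnorm (expsum (v a.+1) n) < eps a)%R%:R + (F n)%:R))).
  by apply: ler_sum => n _; exact: key.
rewrite big_split/= exchange_big/=.
have h1 : \sum_(a < K) \sum_(n < N) (cnorm (expsum (v a.+1) n) < eps a)%R%:R <=
    \sum_(a < K) d / (3 * K.+1%:R) * N%:R.
  apply: ler_sum => a _; move: a; near: N.
  by apply: filter_forall => a; have [] := heps a.
move: h1; rewrite sumr_const card_ord => h1.
have h2 : N%:R / K.+1%:R <= d / 3 * N%:R.
  rewrite mulrC ler_wpM2r// -[leRHS]invf_div lef_pV2 ?posrE ?divr_gt0//.
  exact: ltW.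
have h3 : 1 <= d / 3 * N%:R by near: N; apply: near_le_muln; rewrite divr_gt0.
have h4 : d / (3 * K.+1%:R) * N%:R *+ K <= d / 3 * N%:R.
  rewrite -mulr_natr (_ : _ * _ = d / 3 * N%:R * (K%:R / K.+1%:R)); last by rewrite invfM; ring.
  rewrite -[leRHS]mulr1 ler_wpM2l ?mulr_ge0 ?(ltW d0)// ler_pdivrMr// mul1r ler_nat.
  exact: leqnSn.
apply: (le_trans (lerD h1 (iso N))); apply: (le_trans (lerD h4 (lerD h2 h3))).
by lra.
Unshelve. all: by end_near. Qed.

End small_values.

(** * Lipschitz bounds for cos, sin, ln and cis *)

Section lipschitz.
Context {R : realType}.

Lemma cos_dist (a b : R) : `|cos a - cos b| <= `|a - b|.
Proof.
wlog ab : a b / a <= b.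
  move=> h; case: (leP a b) => [/h//|/ltW ba]; rewrite (distrC (cos a)) (distrC a); exact: h.
rewrite (distrC (cos a)) (distrC a).
have hd (x : R) : x \in `]a, b[ -> is_derive x 1 cos (- sin x).
  by move=> _; exact: is_derive_cos.
have hc : {within `[a, b], continuous (@cos R)}.
  by apply: continuous_subspaceT => x; exact: continuous_cos.
have [c _ ->] := MVT_segment ab hd hc.
by rewrite normrM -[leRHS]mul1r ler_wpM2r// normrN ler_norml sin_geN1 sin_le1.
Qed.

Lemma sin_dist (a b : R) : `|sin a - sin b| <= `|a - b|.
Proof.
have h x : sin x = cos (x - pi / 2) by rewrite cosBpihalf.
by rewrite !h; apply: (le_trans (cos_dist _ _)); rewrite opprB addrA subrK.
Qed.

Lemma ln_dist (m a b : R) : 0 < m -> m <= a -> m <= b -> `|ln a - ln b| <= m^-1 * `|a - b|.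
Proof.
move=> m0; wlog ba : a b / b <= a.
  move=> h ma mb; case: (leP b a) => [/h->//|/ltW ab]; rewrite (distrC (ln a)) (distrC a); exact: h.
move=> ma mb; have a0 : 0 < a by exact: lt_le_trans ma.
have b0 : 0 < b by exact: lt_le_trans mb.
rewrite !ger0_norm ?subr_ge0 ?ler_ln ?posrE//.
rewrite -ln_div ?posrE//.
have -> : a / b = 1 + (a - b) / b by field; rewrite gt_eqF.
apply: (le_trans (le_ln1Dx _)).
  by apply: (@lt_le_trans _ _ 0) => //; rewrite divr_ge0 ?subr_ge0// ltW.
by rewrite mulrC ler_wpM2r ?subr_ge0// lef_pV2.
Qed.

Lemma cis_dist (a b : R) : cnorm (cis a - cis b) <= 4 * pi * `|a - b|.
Proof.
have p0 := pi_gt0 R.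
rewrite [cis a - cis b](_ : _ = (cos (2 * pi * a) - cos (2 * pi * b))%:C +
    'i%C * (sin (2 * pi * a) - sin (2 * pi * b))%:C); last first.
  by rewrite [LHS]complexE.
apply: (le_trans (cnormD _ _)); rewrite cnormM !cnormR cnorm_i.
have -> : 4 * pi * `|a - b| = `|2 * pi * a - 2 * pi * b| + `|2 * pi * a - 2 * pi * b|.
  by rewrite -mulrBr normrM ger0_norm ?mulr_ge0// ?ltW//; ring.
by rewrite mul1r lerD// ?cos_dist ?sin_dist.
Qed.

End lipschitz.

Section dominant_terms.
Context {R : realType}.

Lemma seq_argmax (T : eqType) (f : T -> R) (s : seq T) : s != [::] ->
  exists2 x, x \in s & forall y, y \in s -> f y <= f x.
Proof.
elim: s => // x s IH _; have [->|/IH[z zs hz]] := eqVneq s [::].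
  by exists x; rewrite ?mem_head// => y; rewrite inE => /eqP ->.
have [xz|/ltW zx] := leP (f x) (f z).
  by exists z; rewrite ?inE ?zs ?orbT// => y; rewrite inE => /orP[/eqP ->//|/hz].
exists x; rewrite ?mem_head// => y; rewrite inE => /orP[/eqP ->//|/hz h].
exact: le_trans zx.
Qed.

Lemma expsum_cvg0 (s : seq (R[i] * R[i])) : (forall p, p \in s -> cnorm p.2 < 1) ->
  forall e : R, 0 < e -> \forall n \near \oo, cnorm (expsum s n) <= e.
Proof.
elim: s => [|p s IH] hs e e0.
  by near=> n; rewrite /expsum big_nil cnorm0 ltW.
have e20 : 0 < e / 2 by rewrite divr_gt0.
have {}IH : \forall n \near \oo, cnorm (expsum s n) <= e / 2.
  by apply: IH => // q qs; apply: hs; rewrite inE qs orbT.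
have p1 : `|cnorm p.2| < 1 by rewrite ger0_norm ?cnorm_ge0// hs// mem_head.
have hp : \forall n \near \oo, cnorm p.1 * cnorm p.2 ^+ n <= e / 2.
  have : cnorm p.1 * cnorm p.2 ^+ n @[n --> \oo] --> cnorm p.1 * 0.
    by apply: cvgM; [exact: cvg_cst|exact: cvg_expr].
  rewrite mulr0 => /cvgrPdist_le/(_ _ e20).
  apply: filterS => n; rewrite sub0r normrN ger0_norm//.
  by rewrite mulr_ge0 ?exprn_ge0 ?cnorm_ge0.
near=> n; rewrite /expsum big_cons; apply: (le_trans (cnormD _ _)).
rewrite (splitr e) lerD//; last by near: n.
by rewrite cnormM cnormX; near: n.
Unshelve. all: by end_near. Qed.

Lemma expsum_bounded (s : seq (R[i] * R[i])) : (forall p, p \in s -> cnorm p.2 = 1) ->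
  exists2 C : R, 0 < C & forall n, cnorm (expsum s n) <= C.
Proof.
move=> hs; exists (\sum_(p <- s) cnorm p.1 + 1).
  by rewrite ltr_wpDl// sumr_ge0// => *; exact: cnorm_ge0.
move=> n; apply: (le_trans (cnorm_sum _ _ _)); rewrite -[leLHS]addr0 lerD//.
rewrite big_seq [leRHS]big_seq; apply: ler_sum => p ps.
by rewrite cnormM cnormX hs// expr1n mulr1.
Qed.

End dominant_terms.

Section log_modulus.
Context {R : realType}.

Lemma ln10_gt0 : 0 < ln 10 :> R.
Proof. by rewrite ln_gt0// ltr1n. Qed.

(* At [w = |u|^2] this is [cis (h * log10 |u|)], made Lipschitz by truncating at
   [|u| = e]. *)
Definition log_phase (h : nat) (e w : R) : R[i] :=
  cis (h%:R / 2 * log10 (Num.max w (e ^+ 2))).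

Lemma log_phase_lip (h : nat) (e w w' : R) : 0 < e ->
  cnorm (log_phase h e w - log_phase h e w') <=
    4 * pi * (h%:R / 2) * (e ^- 2 / ln 10) * `|w - w'|.
Proof.
move=> e0; have e20 : 0 < e ^+ 2 by rewrite exprn_gt0.
apply: (le_trans (cis_dist _ _)).
rewrite -mulrBr normrM ger0_norm// !mulrA -!mulrA.
do 2 (rewrite ler_wpM2l ?pi_ge0//); do 2 (rewrite ler_wpM2l//).
rewrite /log10 -mulrBl normrM (gtr0_norm (_ : 0 < (ln 10)^-1)) ?invr_gt0 ?ln10_gt0//.
rewrite [leRHS]mulrCA [leRHS]mulrC ler_wpM2r ?invr_ge0 ?(ltW ln10_gt0)//.
apply: (le_trans (ln_dist e20 _ _)); rewrite ?le_max ?lexx ?orbT//.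
rewrite ler_wpM2l ?invr_ge0 ?(ltW e20)//.
by rewrite ![Num.max _ (e ^+ 2)]maxC; exact: maxr_lip.
Qed.

Lemma log_phaseE (h : nat) (e a : R) : 0 < e -> e <= a ->
  log_phase h e (a ^+ 2) = cis (h%:R * log10 a).
Proof.
move=> e0 ea; have a0 : 0 < a by exact: lt_le_trans ea.
rewrite /log_phase max_l; last by rewrite ler_pXn2r// nnegrE ltW.
by rewrite /log10 lnXn// -mulr_natr; congr cis; field; rewrite gt_eqF// ln10_gt0.
Qed.

(** Real and imaginary part are Lipschitz; scaling [0, C] to [0, 1] brings each under
    [bernstein_approx]. *)
Lemma log_phase_approx (h : nat) (e C d : R) : 0 < e -> 0 < C -> 0 < d ->
  exists p q : {poly R}, forall w, 0 <= w <= C ->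
    cnorm (log_phase h e w - ((p.[w])%:C + 'i%C * (q.[w])%:C)) <= d.
Proof.
move=> e0 C0 d0; have d20 : 0 < d / 2 by rewrite divr_gt0.
set K := 4 * pi * (h%:R / 2) * (e ^- 2 / ln 10).
have K0 : 0 <= K.
  by rewrite !mulr_ge0 ?pi_ge0 ?invr_ge0 ?exprn_ge0 ?(ltW ln10_gt0)// ltW.
have ReIm (z : R[i]) : `|complex.Re z| <= cnorm z /\ `|complex.Im z| <= cnorm z.
  case: z => a b; rewrite /cnorm/= -!sqrtr_sqr; split; rewrite ler_wsqrtr//.
    by rewrite lerDl sqr_ge0.
  by rewrite lerDr sqr_ge0.
have lip (f : R[i] -> R) : (forall z, `|f z| <= cnorm z) ->
    (forall z w, f (z - w) = f z - f w) ->
    exists p : {poly R}, forall w, 0 <= w <= C -> `|f (log_phase h e w) - p.[w]| <= d / 2.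
  move=> f1 fB.
  have [p hp] : exists p : {poly R}, forall v, 0 <= v <= 1 ->
      `|f (log_phase h e (C * v)) - p.[v]| <= d / 2.
    apply: (@bernstein_approx _ (fun v => f (log_phase h e (C * v))) (K * C)) => //.
      by rewrite mulr_ge0// ltW.
    move=> u v _ _; rewrite -fB; apply: (le_trans (f1 _)).
    apply: (le_trans (log_phase_lip _ _ _ e0)).
    by rewrite -mulrBr normrM (gtr0_norm C0) mulrA.
  exists (p \Po (C^-1 *: 'X)) => w /andP[w0 wC].
  rewrite horner_comp !hornerE.
  have := hp (C^-1 * w); rewrite mulrA divff ?gt_eqF// mul1r; apply.
  by rewrite mulr_ge0 ?invr_ge0 ?(ltW C0)//= ler_pdivrMl// mulr1.
have [|//|p hp] := lip (@complex.Re R) _ _; first by move=> z; have [] := ReIm z.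
  by move=> [? ?] [? ?].
have [|//|q hq] := lip (@complex.Im R) _ _; first by move=> z; have [] := ReIm z.
  by move=> [? ?] [? ?].
exists p, q => w wC; rewrite {1}[log_phase _ _ _]complexE opprD addrACA -mulrBr -!rmorphB.
apply: (le_trans (cnormD _ _)); rewrite cnormM cnorm_i mul1r -[X in cnorm X + _]/((_)%:C) -[X in _ + cnorm X]/((_)%:C) !cnormR.
by rewrite (splitr d) lerD ?hp ?hq.
Qed.

End log_modulus.

(** * Equidistribution of the logarithms of power sums *)

Section power_sum_log.
Context {R : realType}.
Variables (rs : seq R[i]) (c : R[i] -> R[i]).
Hypothesis rs_neq0 : rs != [::].
Hypothesis rs_uniq : uniq rs.
Hypothesis term_neq0 : forall r, r \in rs -> r != 0 /\ c r != 0.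
Hypothesis ratio : forall r r' k, r \in rs -> r' \in rs -> (0 < k)%N ->
  r ^+ k = r' ^+ k -> r = r'.
Hypothesis nonresonant : forall (L : R) (h : nat) (s : seq R[i]), 0 < L -> (0 < h)%N ->
  s != [::] -> (forall z, z \in s -> cnorm z = L /\ (z \in rs \/ z^*%C \in rs)) ->
  \prod_(z <- s) z != (L ^+ size s)%:C * cis (- (h%:R * log10 L)).

Section fixed_frequency.
Variables (L : R) (h : nat).
Hypotheses (L_gt0 : 0 < L) (h_gt0 : (0 < h)%N).

(** The bases of the geometric sequences into which the powers of |u_n|^2 expand. *)
Definition unit_monomial (z : R[i]) := exists s : seq R[i],
  (forall r, r \in s -> cnorm r = L /\ (r \in rs \/ r^*%C \in rs)) /\
  z = \prod_(r <- s) (r / L%:C).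

(** Only z = 1 is wanted in the end; quantifying over all monomials makes the class stable under
    multiplication by |u_n|^2. *)
Definition twisted_mean_zero (f : nat -> R[i]) := forall z, unit_monomial z ->
  mean_zero (fun n => (cis (h%:R * log10 L) * z) ^+ n * f n).

Let LC_neq0 : L%:C != 0 :> R[i].
Proof. by rewrite -[0]/(0%:C) (inj_eq (@complexI R)) gt_eqF. Qed.

Lemma cnorm_divL r : cnorm (r / L%:C) = cnorm r / L.
Proof. by rewrite cnormM cnormV cnormR gtr0_norm. Qed.

(** The sequence is geometric on the unit circle, and a ratio equal to 1 would give a product of
    roots the value excluded by [nonresonant]. *)
Lemma twisted1 r0 : r0 \in rs -> cnorm r0 = L -> twisted_mean_zero (fun=> 1).
Proof.
move=> r0rs r0L z [s [hs zE]]; under eq_fun do rewrite mulr1.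
have prodE (s' : seq R[i]) : \prod_(r <- s') (r / L%:C) =
    (\prod_(r <- s') r) / (L ^+ size s')%:C.
  elim: s' => [|r s' IH]; first by rewrite !big_nil expr0 divr1.
  by rewrite !big_cons IH exprS rmorphM invfM mulrACA.
apply: mean_zero_geom.
  rewrite cnormM cnorm_cis mul1r zE; elim: s hs {zE} => [|r s IH] hs.
    by rewrite big_nil cnorm1.
  rewrite big_cons cnormM cnorm_divL; have [-> _] := hs r (mem_head _ _).
  rewrite divff ?gt_eqF// mul1r IH// => r' r's; apply: hs; by rewrite inE r's orbT.
apply/eqP => E.
have {}E : z = cis (- (h%:R * log10 L)).
  by apply: (mulfI (cis_neq0 (h%:R * log10 L))); rewrite E -cisD subrr cis0.
(* [nonresonant] concerns nonempty products; adding r0 and its conjugate, whose normalised product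
   is 1, covers the empty monomial. *)
have [s' [s'0 hs' z'E]] : exists s' : seq R[i], [/\ s' != [::],
    forall r, r \in s' -> cnorm r = L /\ (r \in rs \/ r^*%C \in rs) &
    z = \prod_(r <- s') (r / L%:C)].
  exists [:: r0, r0^*%C & s]; split => //.
    move=> r; rewrite !inE => /or3P[/eqP->|/eqP->|/hs//].
      by split => //; left.
    by rewrite cnorm_conj; split => //; right; rewrite conjcK.
  rewrite !big_cons -zE mulrA mulrACA -cnorm_sqr r0L rmorphXn/= expr2.
  by rewrite -invfM divff ?mul1r// mulf_neq0.
have := nonresonant L_gt0 h_gt0 s'0 hs'; move/eqP; apply.
rewrite -E z'E prodE mulrC divfK// -[0]/(0%:C) (inj_eq (@complexI R)).
by rewrite expf_neq0// gt_eqF.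
Qed.

Lemma twistedD f g : twisted_mean_zero f -> twisted_mean_zero g ->
  twisted_mean_zero (fun n => f n + g n).
Proof.
move=> hf hg z hz; under eq_fun do rewrite mulrDr.
exact: (mean_zeroD (hf _ hz) (hg _ hz)).
Qed.

Lemma twistedZ a f : twisted_mean_zero f -> twisted_mean_zero (fun n => a * f n).
Proof.
move=> hf z hz; under eq_fun do rewrite mulrCA.
exact: (mean_zeroZ a (hf _ hz)).
Qed.

Lemma twisted_sum (I : Type) (s : seq I) (F : I -> nat -> R[i]) :
  (forall i, twisted_mean_zero (F i)) -> twisted_mean_zero (fun n => \sum_(i <- s) F i n).
Proof.
move=> hF z hz; under eq_fun do rewrite mulr_sumr.
exact: (mean_zero_sum s (fun i => hF i z hz)).
Qed.

Lemma twisted_sum_in (I : eqType) (s : seq I) (F : I -> nat -> R[i]) :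
  (forall i, i \in s -> twisted_mean_zero (F i)) ->
  twisted_mean_zero (fun n => \sum_(i <- s) F i n).
Proof.
move=> hF; pose G i := if i \in s then F i else fun=> 0.
rewrite (_ : (fun n => _) = (fun n => \sum_(i <- s) G i n)); last first.
  by apply/funext => n; rewrite big_seq [RHS]big_seq; apply: eq_bigr => i si; rewrite /G si.
apply: twisted_sum => i; rewrite /G; case: ifPn => [/hF//|_ z _].
under eq_fun do rewrite mulr0; exact: mean_zero0.
Qed.

Lemma twisted_monomial w f : unit_monomial w -> twisted_mean_zero f ->
  twisted_mean_zero (fun n => w ^+ n * f n).
Proof.
move=> [s [hs wE]] hf z [s' [hs' zE]].
under eq_fun do rewrite mulrA -exprMn -mulrA.
apply: hf; exists (s' ++ s); split; last by rewrite big_cat/= -zE -wE.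
by move=> r; rewrite mem_cat => /orP[/hs'|/hs].
Qed.

Lemma unit_monomial_root r : r \in rs -> cnorm r = L -> unit_monomial (r / L%:C).
Proof.
move=> hr rL; exists [:: r]; split; last by rewrite big_seq1.
by move=> r'; rewrite inE => /eqP ->; split => //; left.
Qed.

Lemma unit_monomial_conj r : r \in rs -> cnorm r = L -> unit_monomial (r / L%:C)^*%C.
Proof.
move=> hr rL; exists [:: r^*%C]; split.
  move=> r'; rewrite inE => /eqP ->; rewrite cnorm_conj; split => //.
  by right; rewrite conjcK.
by rewrite big_seq1 rmorphM fmorphV -[in RHS](conjc_real L).
Qed.

Definition top := [seq (c r, r / L%:C) | r <- rs & cnorm r == L].

Lemma topP p : p \in top -> exists2 r, r \in rs /\ cnorm r = L & p = (c r, r / L%:C).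
Proof.
by move=> /mapP[r]; rewrite mem_filter => /andP[/eqP rL rrs] ->; exists r.
Qed.

(** |u|^2 is u times its conjugate, hence a combination of n-th powers of unit monomials. *)
Lemma twisted_sqr f : twisted_mean_zero f ->
  twisted_mean_zero (fun n => (cnorm (expsum top n) ^+ 2)%:C * f n).
Proof.
move=> hf.
rewrite (_ : (fun n => _) = (fun n => \sum_(p <- top) p.1 *
    (p.2 ^+ n * \sum_(q <- top) (q.1^*%C * ((q.2)^*%C ^+ n * f n))))); last first.
  apply/funext => n; rewrite cnorm_sqr /expsum rmorph_sum/= mulr_suml mulr_suml.
  apply: eq_bigr => p _; rewrite -!mulrA; congr (_ * (_ * _)).
  rewrite mulr_suml; apply: eq_bigr => q _.
  by rewrite rmorphM/= rmorphXn/=; ring.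
apply: twisted_sum_in => p /topP[r [rrs rL] ->] /=.
apply: twistedZ; apply: twisted_monomial; first exact: unit_monomial_root.
apply: twisted_sum_in => q /topP[r' [r'rs r'L] ->] /=.
by apply: twistedZ; apply: twisted_monomial => //; exact: unit_monomial_conj.
Qed.

Lemma twisted_poly r0 (p : {poly R}) : r0 \in rs -> cnorm r0 = L ->
  twisted_mean_zero (fun n => (p.[cnorm (expsum top n) ^+ 2])%:C).
Proof.
move=> hr0 r0L.
have hX k : twisted_mean_zero (fun n => (cnorm (expsum top n) ^+ 2)%:C ^+ k).
  elim: k => [|k IH]; first by under eq_fun do rewrite expr0; exact: (twisted1 hr0 r0L).
  by under eq_fun do rewrite exprS; exact: (twisted_sqr IH).
rewrite (_ : (fun n => _) = (fun n => \sum_(i < size p)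
   (p`_i)%:C * (cnorm (expsum top n) ^+ 2)%:C ^+ i)); last first.
  apply/funext => n; rewrite horner_coef rmorph_sum/=; apply: eq_bigr => i _.
  by rewrite rmorphM/= rmorphXn.
exact: (twisted_sum _ (fun i : 'I_(size p) => twistedZ _ (hX i))).
Qed.

End fixed_frequency.


Theorem mean_zero_log_modulus (x : nat -> R) (h : nat) :
  (forall n, (x n)%:C = \sum_(r <- rs) c r * r ^+ n) -> (0 < h)%N ->
  mean_zero (fun n => cis (h%:R * log10 `|x n|)).
Proof.
move=> xE h_gt0.
have [r0 r0rs r0max] := seq_argmax cnorm rs_neq0.
set L := cnorm r0; have L_gt0 : 0 < L.
  by rewrite lt_neqAle cnorm_ge0 andbT eq_sym cnorm_eq0; have [] := term_neq0 r0rs.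
have LC0 : L%:C != 0 :> R[i] by rewrite -[0]/(0%:C) (inj_eq (@complexI R)) gt_eqF.
pose u := expsum (top L).
pose low := [seq (c r, r / L%:C) | r <- rs & cnorm r != L].
pose t := expsum low.
have xut n : (x n)%:C = (L ^+ n)%:C * (u n + t n).
  rewrite xE /u /t /expsum !big_map !big_filter /= mulrDr.
  rewrite (bigID (fun r => cnorm r == L))/= !mulr_sumr.
  by congr (_ + _); apply: eq_bigr => r _; rewrite mulrCA rmorphXn/= -exprMn
    [L%:C * _]mulrC divfK.
have t0 : forall e : R, 0 < e -> \forall n \near \oo, cnorm (t n) <= e.
  apply: expsum_cvg0 => p /mapP[r]; rewrite mem_filter => /andP[rL rrs] -> /=.
  by rewrite cnorm_divL// ltr_pdivrMr// mul1r lt_neqAle rL r0max.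
have top1 p : p \in top L -> p.1 != 0 /\ cnorm p.2 = 1.
  move=> /topP[r [rrs rL] ->] /=; have [_ cr] := term_neq0 rrs; split => //.
  by rewrite cnorm_divL// rL divff// gt_eqF.
have [C C0 uC] : exists2 C : R, 0 < C & forall n, cnorm (u n) <= C.
  by apply: expsum_bounded => p /top1[].
have small : forall d : R, 0 < d -> exists2 e : R, 0 < e & \forall N \near \oo,
    \sum_(n < N) (cnorm (u n) < e)%R%:R <= d * N%:R.
  apply: expsum_small_density => //.
  - apply/eqP => /(congr1 (fun s => (c r0, r0 / L%:C) \in s)); rewrite in_nil => /negP; apply.
    by apply/mapP; exists r0; rewrite // mem_filter eqxx.
  - rewrite -map_comp map_inj_uniq ?filter_uniq//.
    by move=> r r' /= /(mulIf (invr_neq0 LC0)).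
  - move=> p q k /topP[r [rrs _] ->] /topP[r' [r'rs _] ->] k0 /=.
    rewrite !exprMn => /(mulIf (expf_neq0 _ (invr_neq0 LC0))) rr'.
    by rewrite (ratio rrs r'rs k0 rr').
apply: mean_zero_approx => e e_gt0.
(* Budget: 2 d where |u| is large, 3 d for the rare small values, d for the initial segment n <= n0.
   The bound d <= 1 serves the crude estimate. *)
pose d := Num.min 1 (e / 8).
have d0 : 0 < d by rewrite lt_min ltr01 divr_gt0.
have d1 : d <= 1 by rewrite ge_min lexx.
have de : 8 * d <= e by rewrite -ler_pdivlMl// mulrC ge_min lexx orbT.
have [e1 e10 he1] := small _ d0.
(* Half of e1: |u| >= e1 and |t| <= eps give |u + t| >= eps, where [log_phase] is not truncated. *)
have [eps eps0 epsE] : exists2 eps : R, 0 < eps & e1 = eps * 2.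
  by exists (e1 / 2); rewrite ?divr_gt0// divfK.
have C20 : 0 < C ^+ 2 by rewrite exprn_gt0.
have [p [q hpq]] := log_phase_approx h eps0 C20 d0.
pose g n : R[i] := (p.[cnorm (u n) ^+ 2])%:C + 'i%C * (q.[cnorm (u n) ^+ 2])%:C.
pose z := cis (h%:R * log10 L).
exists (fun n => z ^+ n * g n); split.
  have hm : unit_monomial L 1 by exists [::]; split => //; rewrite big_nil.
  have := twistedD (twisted_poly L_gt0 h_gt0 p r0rs erefl)
    (twistedZ 'i%C (twisted_poly L_gt0 h_gt0 q r0rs erefl)).
  by move=> /(_ 1 hm); under eq_fun do rewrite mulr1.
pose K := 4 * pi * (h%:R / 2) * (eps ^- 2 / ln 10) : R.
have K0 : 0 <= K.
  by rewrite !mulr_ge0 ?pi_ge0 ?invr_ge0 ?exprn_ge0 ?(ltW ln10_gt0)// ltW.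
(* The squares of |u + t| and |u| differ by at most tau (2 C + eps), which the Lipschitz constant K
   turns into at most d; the + 1 keeps the denominator positive. *)
pose tau := Num.min eps (d / (K * (2 * C + eps) + 1)).
have D0 : 0 < K * (2 * C + eps) + 1.
  have : 0 <= 2 * C + eps by lra.
  by move=> /(mulr_ge0 K0); lra.
have tau0 : 0 < tau by rewrite lt_min eps0 divr_gt0.
have [n0 _ hn0] := t0 _ tau0.
have gle n : cnorm (z ^+ n * g n) <= 1 + d.
  rewrite cnormM cnormX cnorm_cis expr1n mul1r.
  rewrite -[g n](subrK (log_phase h eps (cnorm (u n) ^+ 2))) addrC.
  apply: (le_trans (cnormD _ _)); rewrite cnorm_cis lerD2l cnorm_distC hpq//.
  by rewrite sqr_ge0/= ler_pXn2r ?nnegrE ?cnorm_ge0// ltW.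
(* Valid for every n, including those with x n = 0, where [ln] takes the value 0. *)
have crude n : cnorm (cis (h%:R * log10 `|x n|) - z ^+ n * g n) <= 3.
  by apply: (le_trans (cnormB _ _)); rewrite cnorm_cis; have := gle n; lra.
have fine n : (n0 <= n)%N -> e1 <= cnorm (u n) ->
    cnorm (cis (h%:R * log10 `|x n|) - z ^+ n * g n) <= 2 * d.
  move=> /hn0/= tn un; set v := cnorm (u n + t n).
  have xv : `|x n| = L ^+ n * v.
    by rewrite -cnormR xut cnormM cnormR ger0_norm// exprn_ge0// ltW.
  have vu : `|v - cnorm (u n)| <= tau.
    apply: (le_trans (cnorm_dist _ _)); apply: le_trans tn.
    by rewrite addrAC subrr add0r.
  have tau1 : tau <= eps by rewrite ge_min lexx.
  have tau2 : tau * (K * (2 * C + eps) + 1) <= d.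
    by rewrite -ler_pdivlMr// ge_min lexx orbT.
  have veps : eps <= v.
    by move: vu; rewrite ler_norml => /andP[+ _]; lra.
  have v0 : 0 < v by exact: lt_le_trans veps.
  have -> : cis (h%:R * log10 `|x n|) = z ^+ n * log_phase h eps (v ^+ 2).
    rewrite log_phaseE// -cisMn -cisD; congr cis.
    rewrite xv /log10 lnM ?posrE ?exprn_gt0// lnXn// -mulr_natr.
    by field; rewrite gt_eqF// ln10_gt0.
  rewrite -mulrBr cnormM cnormX cnorm_cis expr1n mul1r.
  rewrite -[log_phase _ _ _](subrK (log_phase h eps (cnorm (u n) ^+ 2))) -addrA.
  apply: (le_trans (cnormD _ _)); rewrite mulr2n mulrDl mul1r lerD//; last first.
    by rewrite hpq// sqr_ge0/= ler_pXn2r ?nnegrE ?cnorm_ge0// ltW.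
  apply: (le_trans (log_phase_lip _ _ _ eps0)); rewrite -/K.
  rewrite subr_sqr normrM.
  have sum_le : `|v + cnorm (u n)| <= 2 * C + eps.
    rewrite ger0_norm ?addr_ge0 ?cnorm_ge0//.
    have := uC n; move: vu; rewrite ler_norml => /andP[_ +]; lra.
  apply: le_trans tau2.
  apply: (@le_trans _ _ (K * (tau * (2 * C + eps)))).
    by rewrite ler_wpM2l// ler_pM.
  by rewrite [tau * (_ + 1)]mulrDr mulr1 mulrCA lerDl ltW.
near=> N.
apply: (@le_trans _ _ (\sum_(n < N) (2 * d + (3 * (cnorm (u n) < e1)%R%:R +
    3 * (n%:R <= n0%:R :> R)%R%:R)))).
  have tt : (nat_of_bool true)%:R = 1 :> R by [].
  have ff : (nat_of_bool false)%:R = 0 :> R by [].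
  apply: ler_sum => n _; case: (leP n%:R n0%:R) => nn0.
    apply: (le_trans (crude n)); rewrite tt mulr1 addrA lerDr addr_ge0 ?mulr_ge0//.
    exact: ltW.
  rewrite ff mulr0 addr0; case: (ltP (cnorm (u n)) e1) => un.
    by apply: (le_trans (crude n)); rewrite tt mulr1 lerDr mulr_ge0// ltW.
  rewrite ff mulr0 addr0; apply: fine => //.
  by rewrite ltr_nat in nn0; exact: ltnW.
rewrite big_split big_split/= -!mulr_sumr sumr_const card_ord -[_ *+ N]mulr_natr.
have h1 : \sum_(n < N) (cnorm (u n) < e1)%R%:R <= d * N%:R by near: N.
have h2 : \sum_(n < N) (n%:R <= n0%:R :> R)%R%:R <= n0%:R + 1 :> R by exact: sum_le_nat.
have h3 : 3 * (n0%:R + 1) <= d * N%:R by near: N; exact: near_le_muln.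
have h4 : 8 * d * N%:R <= e * N%:R by rewrite ler_wpM2r.
have h5 : 0 <= d * N%:R by rewrite mulr_ge0// ltW.
lra.
Unshelve. all: by end_near. Qed.

End power_sum_log.

(** * Benford sequences *)

Section significand_log.
Context {R : realType}.

Lemma ln_exprz (k : int) : ln ((10 : R) ^ k) = k%:~R * ln 10.
Proof.
case: k => n; first by rewrite -exprnP lnXn// mulr_natl.
rewrite NegzE -invr_expz -exprnP lnV ?posrE ?exprn_gt0// lnXn// mulrNz mulNr.
by rewrite mulr_natl.
Qed.

Lemma significand_floor (x : R) : 0 < x ->
  0 < significand x /\ log10 (significand x) = log10 x - (Num.floor (log10 x))%:~R.
Proof.
move=> x0; rewrite /significand gt_eqF//; set S := [set s : R | _].
have l10 : 0 < ln 10 :> R by exact: ln10_gt0.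
suff [h1 [k hk]] : S (xget 0 S).
  move: (xget 0 S) h1 hk => s /andP[s1 s10] xE; have s0 : 0 < s by exact: lt_le_trans s1.
  split=> //; have E : log10 x = k%:~R + log10 s.
    by rewrite xE /log10 lnM ?posrE ?exprz_gt0// ln_exprz mulrDl mulfK// gt_eqF.
  suff -> : Num.floor (log10 x) = k by rewrite E addrC addKr.
  apply: floor_def; rewrite E intrD lerDl ltrD2l /log10 divr_ge0 ?ln_ge0 ?ler1n ?(ltW l10)//=.
  by rewrite ltr_pdivrMr// mul1r ltr_ln ?posrE.
set m := Num.floor (log10 x); pose s := x / 10 ^ m.
have s0 : 0 < s by rewrite divr_gt0// exprz_gt0.
have lns : ln s = ln x - m%:~R * ln 10.
  by rewrite ln_div ?posrE ?exprz_gt0// ln_exprz.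
have /andP[f1 f2] := floor_itv (log10 x); rewrite -/m in f1 f2.
apply: (@xgetPex _ 0); exists s; split; last first.
  by exists m; rewrite /s mulrC divfK// gt_eqF// exprz_gt0.
apply/andP; split.
  rewrite -ler_ln ?posrE// ln1 lns subr_ge0.
  by rewrite -ler_pdivlMr.
rewrite -ltr_ln ?posrE// lns ltrBlDl.
by move: f2; rewrite intrD ltr_pdivrMr// mulrDl mul1r.
Qed.

(** At x = 0 both sides are true, since [significand 0] and [ln 0] are 0: zero terms are counted
    alike by [benford] and by fractional parts. *)
Lemma significand_le (x t : R) : 0 <= x -> 1 <= t ->
  (significand x <= t) = (log10 x - (Num.floor (log10 x))%:~R <= log10 t).
Proof.
rewrite le_eqVlt => /orP[/eqP <-|x0] t1.
  rewrite /significand eqxx /log10 ln0// mul0r floor0 subrr.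
  by rewrite (le_trans ler01 t1) divr_ge0 ?ln_ge0// ler1n.
have [s0 <-] := significand_floor x0.
by rewrite /log10 ler_pM2r ?invr_gt0 ?ln10_gt0// ler_ln ?posrE// (lt_le_trans ltr01 t1).
Qed.

Lemma benford_of_mean_zero (x : nat -> R) :
  (forall h : nat, (0 < h)%N -> mean_zero (fun n => cis (h%:R * log10 `|x n.+1|))) ->
  benford x.
Proof.
move=> hx t /andP[t1 t10].
have t0 : 0 < t by exact: lt_le_trans t1.
have l01 : 0 <= log10 t < 1.
  rewrite /log10 divr_ge0 ?ln_ge0 ?ler1n//=.
  by rewrite ltr_pdivrMr ?ln10_gt0// mul1r ltr_ln ?posrE.
have := weyl_criterion hx l01; apply: cvg_trans; apply: near_eq_cvg; near=> N.
congr (_ / _); rewrite -sum1_count natr_sum.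
rewrite -[iota 1 N]/(iota (1 + 0) N) iotaDl big_map -[X in iota 0 X]subn0 big_mkord.
rewrite [RHS]big_mkcond; apply: eq_bigr => n _; rewrite add1n -significand_le//; by case: ifP.
Unshelve. all: by end_near. Qed.

End significand_log.

(** * Spectral decomposition of a positive chain *)

Section quotient_matrix.
Variables (n : nat).

(** The action on columns modulo constants, in the coordinates x_i - x_max. It is linear in M and
    does not see the last column. *)
Definition quot_mx (S : pzRingType) (M : 'M[S]_n.+2) : 'M[S]_n.+1 :=
  \matrix_(i, j) (M (lift ord_max i) (lift ord_max j) - M ord_max (lift ord_max j)).

(** The quotient map by constant columns; its rows span the row vectors of sum zero. *)
Definition diff_mx (S : pzRingType) : 'M[S]_(n.+1, n.+2) :=
  \matrix_(i, j) ((j == lift ord_max i)%:R - (j == ord_max)%:R).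

Lemma diff_mxE (S : pzRingType) p (N : 'M[S]_(n.+2, p)) i j :
  (diff_mx S *m N) i j = N (lift ord_max i) j - N ord_max j.
Proof.
rewrite mxE (bigD1 (lift ord_max i))//= (bigD1 ord_max) ?neq_lift//=.
rewrite big1 ?addr0; last first.
  by move=> k /andP[k1 k2]; rewrite mxE (negbTE k1) (negbTE k2) subrr mul0r.
rewrite !mxE !eqxx [ord_max == _](negbTE (neq_lift _ _)).
by rewrite [lift _ _ == _]eq_sym (negbTE (neq_lift _ _)) subr0 sub0r mul1r mulN1r.
Qed.

Lemma big_lift_max (S : nmodType) (F : 'I_n.+2 -> S) :
  \sum_j F j = \sum_j F (lift ord_max j) + F ord_max.
Proof.
rewrite (bigD1 ord_max)//= addrC; congr (_ + _).
rewrite (reindex_omap (lift ord_max) (unlift ord_max)) => [|j].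
  by apply: eq_bigl => j; rewrite liftK eqxx andbT eq_sym neq_lift.
by move=> j0; case: unliftP => [k ->//|jm]; rewrite jm eqxx in j0.
Qed.

Lemma mul_diff_mx (S : pzRingType) (M : 'M[S]_n.+2) : (forall i, \sum_j M i j = 1) ->
  diff_mx S *m M = quot_mx M *m diff_mx S.
Proof.
move=> M1; apply/matrixP => i j; rewrite diff_mxE [RHS]mxE.
have lift_lift (a b : 'I_n.+1) : (lift ord_max a == lift ord_max b) = (a == b).
  by rewrite (inj_eq (@lift_inj _ _)).
have [j' ->|->] := unliftP ord_max j.
  rewrite (bigD1 j')//= big1 ?addr0 => [|k kj].
    by rewrite !mxE eqxx [lift _ _ == ord_max]eq_sym (negbTE (neq_lift _ _)) subr0 mulr1.
  rewrite !mxE lift_lift eq_sym (negbTE kj).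
  by rewrite [lift _ _ == ord_max]eq_sym (negbTE (neq_lift _ _)) subr0 mulr0.
(* The last column is recovered from the row sums. *)
rewrite (eq_bigr (fun k => - M (lift ord_max i) (lift ord_max k) + M ord_max (lift ord_max k))).
  rewrite big_split/= sumrN.
  have := M1 (lift ord_max i); rewrite big_lift_max => /eqP; rewrite addrC eq_sym -subr_eq => /eqP <-.
  have := M1 ord_max; rewrite big_lift_max => /eqP; rewrite addrC eq_sym -subr_eq => /eqP <-.
  by rewrite opprB addrA subrK.
move=> k _; rewrite !mxE (negbTE (neq_lift _ _)) eqxx sub0r mulrN1 opprB addrC.
by [].
Qed.

Lemma mul_diff_mx_horner (S : comNzRingType) (M : 'M[S]_n.+2) p :
  (forall i, \sum_j M i j = 1) ->
  diff_mx S *m horner_mx M p = horner_mx (quot_mx M) p *m diff_mx S.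
Proof.
move=> /mul_diff_mx M1; elim/poly_ind: p => [|p c IH].
  by rewrite !rmorph0 mulmx0 mul0mx.
rewrite !rmorphD !rmorphM/= !horner_mx_X !horner_mx_C mulmxDr mulmxDl.
by rewrite mulmxA IH -!mulmxA M1 scalar_mxC.
Qed.

(* [diff_mx] intertwines [M] with its quotient, so all rows of [chi_A(M)] agree. *)
Lemma quot_char_poly_annihilates (S : comNzRingType) (M : 'M[S]_n.+2) :
  (forall i, \sum_j M i j = 1) ->
  horner_mx M (('X - 1%:P) * char_poly (quot_mx M)) = 0.
Proof.
move=> M1; rewrite rmorphM rmorphB/= horner_mx_X horner_mx_C.
set N := horner_mx M _.
have N_rows i j : N i j = N ord_max j.
  have [i' ->|->//] := unliftP ord_max i.
  apply/eqP; rewrite -subr_eq0 -diff_mxE mul_diff_mx_horner//.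
  by rewrite Cayley_Hamilton mul0mx mxE.
apply/matrixP => i j; rewrite -[LHS]/(((M - 1%:M) *m N) i j) mulmxBl mul1mx !mxE.
under eq_bigr do rewrite N_rows; by rewrite -mulr_suml M1 mul1r N_rows subrr.
Qed.

End quotient_matrix.

Section spectral_decomposition.
Variables (F : fieldType) (n : nat).

(** Lagrange interpolation: X ^ k minus the interpolant of its values on [rs] vanishes on [rs], so
    the annihilating polynomial divides it; [E r] is the Lagrange polynomial of r evaluated at M. *)
Lemma exp_mx_distinct_roots (M : 'M[F]_n.+1) (rs : seq F) : uniq rs ->
  horner_mx M (\prod_(r <- rs) ('X - r%:P)) = 0 ->
  exists E : F -> 'M[F]_n.+1, forall k, M ^+ k = \sum_(r <- rs) r ^+ k *: E r.
Proof.
move=> urs M0.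
pose lag r : {poly F} := \prod_(t <- rs | t != r) ((r - t)^-1 *: ('X - t%:P)).
have lagE r t : r \in rs -> t \in rs -> (lag r).[t] = (r == t)%:R.
  move=> rr tr; rewrite /lag horner_prod; have [<-|rt] := eqVneq r t.
    rewrite big1// => u ur; rewrite !hornerE mulVf// subr_eq0 eq_sym//.
  apply/eqP; rewrite prodf_seq_eq0; apply/hasP; exists t => //.
  by rewrite eq_sym rt !hornerE subrr mulr0 eqxx.
exists (fun r => horner_mx M (lag r)) => k.
suff : horner_mx M ('X^k - \sum_(r <- rs) r ^+ k *: lag r) = 0.
  rewrite rmorphB/= rmorphXn/= horner_mx_X => /eqP; rewrite subr_eq0 => /eqP ->.
  by rewrite raddf_sum/=; apply: eq_bigr => r _; rewrite linearZ.
suff /dvdpP[q ->] : \prod_(r <- rs) ('X - r%:P) %| 'X^k - \sum_(r <- rs) r ^+ k *: lag r.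
  by rewrite rmorphM/= M0 mulr0.
apply: uniq_roots_dvdp; last by rewrite uniq_rootsE.
apply/allP => t tr; rewrite /root !hornerE horner_sum.
rewrite (bigD1_seq t)//= hornerZ lagE// eqxx mulr1 big_seq_cond big1 ?addr0 ?subrr//.
by move=> r /andP[rr rt]; rewrite hornerZ lagE// (negbTE rt) mulr0.
Qed.

(* Up to sign, the discriminant of the characteristic polynomial. *)
Definition disc_mx (S : comNzRingType) (m : nat) (B : 'M[S]_m.+1) : S :=
  \det (horner_mx B (char_poly B)^`()).

(** Used to pass from R to R[i], and from a matrix of polynomials to its values along a ray. *)
Lemma map_disc_mx (S T : comNzRingType) (f : {rmorphism S -> T}) m (B : 'M[S]_m.+1) :
  f (disc_mx B) = disc_mx (map_mx f B).
Proof. by rewrite /disc_mx -det_map_mx map_horner_mx -deriv_map map_char_poly. Qed.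

Lemma eigen_horner m (B : 'M[F]_m.+1) (v : 'rV[F]_m.+1) a p : v *m B = a *: v ->
  v *m horner_mx B p = p.[a] *: v.
Proof.
move=> vB; elim/poly_ind: p => [|p c IH].
  by rewrite rmorph0 horner0 mulmx0 scale0r.
rewrite rmorphD rmorphM/= horner_mx_X horner_mx_C mulmxDr mulmxA IH -scalemxAl vB.
by rewrite scalerA mul_mx_scalar hornerD hornerM hornerX hornerC scalerDl.
Qed.

(** At a multiple root, an eigenvector would be killed by the derivative of the characteristic
    polynomial at B, an invertible matrix. *)
Lemma disc_mx_neq0 m (B : 'M[F]_m.+1) a : disc_mx B != 0 -> root (char_poly B) a ->
  ~~ root (char_poly B)^`() a.
Proof.
move=> B0; rewrite -eigenvalue_root_char => /eigenvalueP[v vB v0].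
apply/negP => /rootP ra; have := eigen_horner (char_poly B)^`() vB.
rewrite ra scale0r => vD; move: B0; rewrite /disc_mx -unitfE -unitmxE => uD.
by move: v0; rewrite -(mulmxK uD v) vD mul0mx eqxx.
Qed.

Lemma separable_uniq (rs : seq F) (p : {poly F}) : p = \prod_(r <- rs) ('X - r%:P) ->
  (forall a, root p a -> ~~ root p^`() a) -> uniq rs.
Proof.
elim: rs p => // a s IH p; rewrite big_cons; set q := \prod_(_ <- s) _ => -> sep.
have derE b : (('X - a%:P) * q)^`().[b] = q.[b] + (b - a) * q^`().[b].
  by rewrite derivM derivB derivX derivC subr0 mul1r !hornerE.
rewrite /= (IH q)// ?andbT.
  apply/negP; rewrite -root_prod_XsubC -/q => qa.
  have := sep a; rewrite rootM qa orbT => /(_ isT) /negP; apply.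
  by rewrite /root derE subrr mul0r addr0.
move=> b qb; apply/negP => q'b; have := sep b; rewrite rootM qb orbT => /(_ isT) /negP; apply.
by rewrite /root derE (rootP qb) (rootP q'b) mulr0 addr0.
Qed.

End spectral_decomposition.

Section distinct_powers.
Variables (F : closedFieldType) (n : nat) (A : 'M[F]_n.+1).

Lemma disc_mx_roots (B : 'M[F]_n.+1) : disc_mx B != 0 ->
  exists rs : seq F, [/\ char_poly B = \prod_(r <- rs) ('X - r%:P), uniq rs &
    size rs = n.+1].
Proof.
move=> B0; have [rs Brs] := closed_field_poly_normal (char_poly B).
rewrite (monicP (char_poly_monic B)) scale1r in Brs.
exists rs; split => //; first by apply: (separable_uniq Brs) => a; exact: disc_mx_neq0.
by have := size_char_poly B; rewrite Brs size_prod_XsubC => -[].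
Qed.

(* If two eigenvalues of [A] had the same [k]-th power, [A ^+ k] would be annihilated
   by a polynomial with fewer roots than it has eigenvalues. *)
Lemma eigenvalue_powers_inj k : disc_mx A != 0 -> disc_mx (A ^+ k) != 0 ->
  {in root (char_poly A) &, injective (fun r : F => r ^+ k)}.
Proof.
move=> /disc_mx_roots[rs [Ars urs srs]] /disc_mx_roots[ws [Bws uws sws]].
pose zs := undup [seq r ^+ k | r <- rs]; pose g := \prod_(z <- zs) ('X - z%:P).
have g0 : horner_mx (A ^+ k) g = 0.
  suff /dvdpP[q gq] : char_poly A %| g \Po 'X^k.
    rewrite (_ : horner_mx _ g = horner_mx A (g \Po 'X^k)).
      by rewrite gq rmorphM/= Cayley_Hamilton mulr0.
    elim/poly_ind: (g) => [|p c IH]; first by rewrite comp_poly0 !rmorph0.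
    rewrite comp_polyD comp_polyM comp_polyX comp_polyC !rmorphD !rmorphM/= IH.
    by rewrite !horner_mx_X !horner_mx_C rmorphXn/= horner_mx_X.
  rewrite Ars; apply: uniq_roots_dvdp; last by rewrite uniq_rootsE.
  apply/allP => r rr; rewrite root_comp hornerXn root_prod_XsubC mem_undup.
  by apply/mapP; exists r.
have sub : {subset ws <= zs}.
  move=> w ww; rewrite -root_prod_XsubC -/g.
  have : root (char_poly (A ^+ k)) w by rewrite Bws root_prod_XsubC.
  rewrite -eigenvalue_root_char => /eigenvalueP[v vB v0].
  have := eigen_horner g vB; rewrite g0 mulmx0 => /esym/eqP.
  by rewrite scaler_eq0 (negbTE v0) orbF.
(* The n + 1 eigenvalues of A ^ k are distinct and lie in [zs], so [undup] removed nothing. *)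
have : uniq [seq r ^+ k | r <- rs].
  have := uniq_leq_size uws sub; rewrite sws -srs -(size_map (fun r => r ^+ k)).
  by rewrite leqNgt ltn_size_undup negbK.
move=> uk r r'; rewrite -[r \in _]/(root _ r) -[r' \in _]/(root _ r').
rewrite Ars !root_prod_XsubC => rr r'r /= eqk.
have i1 : (index r rs < size rs)%N by rewrite index_mem.
have i2 : (index r' rs < size rs)%N by rewrite index_mem.
have := nth_uniq 0 _ _ uk; rewrite size_map => /(_ _ _ i1 i2).
rewrite !(nth_map 0)// !nth_index// eqk eqxx => /esym/eqP e.
by rewrite -(nth_index 0 rr) -(nth_index 0 r'r) e.
Qed.

End distinct_powers.

Section kronecker_power.
Variables (m : nat).

Definition kron_idx j (a : 'I_#|{ffun 'I_j -> 'I_m}|) : {ffun 'I_j -> 'I_m} := enum_val a.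

Definition kron_pow (S : comPzRingType) (A : 'M[S]_m) (j : nat) :
    'M[S]_#|{ffun 'I_j -> 'I_m}| :=
  \matrix_(a, b) \prod_(i < j) A (kron_idx a i) (kron_idx b i).

Lemma map_kron_pow (S T : comPzRingType) (f : {rmorphism S -> T}) (A : 'M[S]_m) j :
  map_mx f (kron_pow A j) = kron_pow (map_mx f A) j.
Proof.
by apply/matrixP => a b; rewrite !mxE rmorph_prod; apply: eq_bigr => i _; rewrite mxE.
Qed.

Lemma kron_powZ (S : comPzRingType) (s : S) (A : 'M[S]_m) j :
  kron_pow (s *: A) j = s ^+ j *: kron_pow A j.
Proof.
apply/matrixP => a b; rewrite !mxE.
under eq_bigr do rewrite mxE; by rewrite big_split/= prodr_const card_ord.
Qed.

(** The tensor product of left eigenvectors is an eigenvector, nonzero at the index made of nonzero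
    coordinates of the factors. *)
Lemma kron_pow_root (F : fieldType) (A : 'M[F]_m) (j : nat) (r : 'I_j -> F) :
  (forall i, root (char_poly A) (r i)) -> root (char_poly (kron_pow A j)) (\prod_i r i).
Proof.
move=> Ar.
have /fin_all_exists2[v vA v0] : forall i, exists2 v : 'rV_m, v *m A = r i *: v & v != 0.
  by move=> i; apply/eigenvalueP; rewrite eigenvalue_root_char.
rewrite -eigenvalue_root_char; apply/eigenvalueP.
exists (\row_a \prod_i v i 0 (kron_idx a i)).
  apply/rowP => b; rewrite !mxE.
  transitivity (\prod_i \sum_k v i 0 k * A k (kron_idx b i)); last first.
    rewrite -big_split/=; apply: eq_bigr => i _.
    by have /rowP/(_ (kron_idx b i)) := vA i; rewrite !mxE.
  rewrite bigA_distr_bigA/= [RHS](reindex _ (onW_bij _ (enum_val_bij _))).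
  by apply: eq_bigr => a _; rewrite !mxE -big_split.
have nz i : exists k, v i 0 k != 0.
  have /matrix0Pn[i0 [k]] := v0 i; rewrite ord1 => h; by exists k.
have [k hk] := fin_all_exists nz.
apply/eqP => /rowP/(_ (enum_rank [ffun i => k i])); rewrite !mxE => /eqP.
rewrite /kron_idx enum_rankK prodf_seq_eq0 => /hasP[i _]; rewrite ffunE.
by rewrite (negbTE (hk i)).
Qed.

End kronecker_power.

(** * Contraction on row vectors of sum zero *)

Section contraction.
Context {R : realType}.
Variables (n : nat) (M : 'M[R]_n.+2).
Hypothesis M_gt0 : forall i j, 0 < M i j.
Hypothesis M_sum1 : forall i, \sum_j M i j = 1.

(** Doeblin's minorisation: all entries are at least e, so subtracting the uniform matrix with row
    sums e leaves a nonnegative one. *)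
Lemma positive_mx_gap : exists2 e : R, 0 < e < 1 &
  forall i, \sum_j `|M i j - e / n.+2%:R| = 1 - e.
Proof.
(* The default 1/2 ensures e < 1. *)
pose e := \big[Num.min/2^-1]_(p : 'I_n.+2 * 'I_n.+2) M p.1 p.2.
have e0 : 0 < e by rewrite lt_bigmin// => p _; exact: M_gt0.
have e1 : e < 1.
  by apply: (@le_lt_trans _ _ 2^-1); [exact: bigmin_le_id|rewrite invf_lt1// ltr1n].
exists e; first by rewrite e0.
move=> i; transitivity (\sum_j (M i j - e / n.+2%:R)).
  apply: eq_bigr => j _; rewrite ger0_norm// subr_ge0.
  apply: (@le_trans _ _ e); last exact: (@bigmin_le _ _ _ _ (i, j) (fun p => M p.1 p.2)).
  by rewrite ler_pdivrMr// ler_peMr ?ler1n// ltW.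
by rewrite sumrB M_sum1 sumr_const card_ord -[_ *+ _]mulr_natr divfK.
Qed.

(** A left eigenvector of the quotient, multiplied by [diff_mx], is one of M with sum zero. On such
    vectors M acts as M minus a uniform matrix, which contracts the l^1 norm by 1 - e. *)
Lemma quot_root_lt1 (r : R[i]) :
  root (char_poly (quot_mx (map_mx (real_complex R) M))) r -> cnorm r < 1.
Proof.
set MC := map_mx _ M.
have MC1 i : \sum_j MC i j = 1.
  by under eq_bigr do rewrite mxE; rewrite -rmorph_sum/= M_sum1.
rewrite -eigenvalue_root_char => /eigenvalueP[u uA u0].
pose p := u *m diff_mx n _.
have pM : p *m MC = r *: p by rewrite /p -mulmxA mul_diff_mx// mulmxA uA scalemxAl.
have p0 : \sum_j p 0 j = 0.
  have : (diff_mx n R[i] *m const_mx 1 : 'cV__) = 0.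
    by apply/matrixP => i j; rewrite diff_mxE !mxE subrr.
  move=> h; have : (p *m (const_mx 1 : 'cV_n.+2)) 0 0 = 0 by rewrite -mulmxA h mulmx0 mxE.
  rewrite mxE => E; rewrite -[RHS]E.
  by apply: eq_bigr => j _; rewrite [const_mx _ _ _]mxE mulr1.
have p_lift j : p 0 (lift ord_max j) = u 0 j.
  rewrite mxE (bigD1 j)//= big1 ?addr0.
    by rewrite !mxE eqxx [_ == ord_max]eq_sym (negbTE (neq_lift _ _)) subr0 mulr1.
  move=> k kj; rewrite !mxE (inj_eq (@lift_inj _ _)) eq_sym (negbTE kj).
  by rewrite [_ == ord_max]eq_sym (negbTE (neq_lift _ _)) subr0 mulr0.
have norm_gt0 : 0 < \sum_j cnorm (p 0 j).
  have /matrix0Pn[i0 [k]] := u0; rewrite ord1 -p_lift => pk.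
  rewrite (bigD1 (lift ord_max k))//= ltr_pwDl ?sumr_ge0//; last first.
    by move=> *; exact: cnorm_ge0.
  by rewrite lt_neqAle cnorm_ge0 eq_sym cnorm_eq0 pk.
have [e /andP[e0 e1] he] := positive_mx_gap.
have : cnorm r * \sum_j cnorm (p 0 j) <= (1 - e) * \sum_j cnorm (p 0 j).
  rewrite [leRHS]mulr_sumr; under [leRHS]eq_bigr => i _ do rewrite -(he i) mulr_suml.
  rewrite exchange_big mulr_sumr; apply: ler_sum => j _.
  rewrite -cnormM; have /rowP/(_ j) := pM; rewrite [RHS]mxE => <-.
  rewrite mxE (_ : \sum_k _ = \sum_k p 0 k * (M k j - e / n.+2%:R)%:C); last first.
    under [RHS]eq_bigr do rewrite rmorphB mulrBr.
    rewrite sumrB -mulr_suml p0 mul0r subr0; apply: eq_bigr => k _; by rewrite !mxE.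
  apply: (le_trans (cnorm_sum _ _ _)); apply: ler_sum => k _.
  by rewrite cnormM cnormR mulrC.
by rewrite ler_pM2r// => /le_lt_trans; apply; rewrite ltrBlDr ltrDl.
Qed.

End contraction.

Section positive_chain.
Context {R : realType}.
Local Notation C := R[i].
Local Notation toC := (map_mx (real_complex R)).

Lemma real_complexB (x y : R) : (x - y)%:C = x%:C - y%:C.
Proof. exact: rmorphB. Qed.

Lemma power_sum_benford (rs : seq C) (c : C -> C) (x : nat -> R) : uniq rs ->
  (forall r r' k, r \in rs -> r' \in rs -> (0 < k)%N -> r ^+ k = r' ^+ k -> r = r') ->
  (forall (L : R) (h : nat) (s : seq C), 0 < L -> (0 < h)%N -> s != [::] ->
    (forall z, z \in s -> cnorm z = L /\ (z \in rs \/ z^*%C \in rs)) ->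
    \prod_(z <- s) z != (L ^+ size s)%:C * cis (- (h%:R * log10 L))) ->
  (forall n, (x n)%:C = \sum_(r <- rs) c r * r ^+ n) ->
  benford x \/ eventually_zero x.
Proof.
move=> urs ratio nonres xE.
(* Base 0 contributes only at n = 0, which [benford] does not inspect; if no term remains, the
   sequence is zero from n = 1 on. *)
pose ts := [seq r <- rs | (r != 0) && (c r != 0)].
have xSE n : (x n.+1)%:C = \sum_(r <- ts) (c r * r) * r ^+ n.
  rewrite xE big_filter [RHS]big_mkcond/=; apply: eq_bigr => r _.
  rewrite exprS mulrA; case: ifP => // /negbT; rewrite negb_and !negbK.
  by move=> /orP[]/eqP ->; rewrite ?(mulr0, mul0r).
have tsrs r : r \in ts -> r \in rs by rewrite mem_filter => /andP[].
have [ts0|ts0] := eqVneq ts [::].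
  right; near=> n; have n0 : (0 < n)%N by near: n; exact: nbhs_infty_gt.
  by apply: complexI; rewrite -(prednK n0) xSE ts0 big_nil.
left; apply: benford_of_mean_zero => h h0.
apply: (@mean_zero_log_modulus _ ts (fun r => c r * r)) => //.
- exact: filter_uniq.
- move=> r; rewrite mem_filter => /andP[/andP[r0 cr0] _].
  by split => //; rewrite mulf_neq0.
- by move=> r r' k /tsrs ? /tsrs; exact: ratio.
- move=> L k s L0 k0 s0 hs; apply: nonres => // z /hs[zL zr]; split => //.
  by case: zr => /tsrs; [left|right].
Unshelve. all: by end_near. Qed.

Lemma cvg_mx_entries d (F : nat -> 'M[R]_d) (L : 'M[R]_d) :
  (forall i j e, 0 < e -> \forall n \near \oo, `|L i j - F n i j| < e) ->
  F n @[n --> \oo] --> L.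
Proof.
move=> h; apply/cvg_ballP => e e0; near=> n; split => //.
near: n; apply: filter_forall => i; apply: filter_forall => j.
exact: h.
Unshelve. all: by end_near. Qed.

(* The value of a product of [j] eigenvalues of modulus [L = expR t] that is
   forbidden: [L ^+ j * cis (- h log10 L)]. *)
Definition resonance (j h : nat) (t : R) : C :=
  (expR (j%:R * t))%:C * cis (- (h%:R * (t / ln 10))).

Lemma positive_generic_benford n (M : 'M[R]_n.+2) :
  (forall i j, 0 < M i j) -> (forall i, \sum_j M i j = 1) ->
  (forall k, (0 < k)%N -> disc_mx (quot_mx M ^+ k) != 0) ->
  (forall j h t, (0 < j)%N -> (0 < h)%N ->
    ~~ root (char_poly (toC (kron_pow (quot_mx M) j))) (resonance j h t)) ->
  benford_matrix M.
Proof.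
move=> M_gt0 M_sum1 disc nonres.
have stoch : row_stochastic M.
  move=> i; split => [j|]; first by rewrite tnth_mktuple ltW.
  by rewrite -(M_sum1 i); apply: eq_bigr => j _; rewrite tnth_mktuple.
have irr : irreducible M by move=> i j; exists 1%N; rewrite ?expr1.
have aper : aperiodic M.
  move=> i; split; first by move=> k _; exact: dvd1n.
  by move=> k; apply; rewrite /= expr1.
split => // i j.
pose MC := toC M; pose A := toC (quot_mx M).
have MC1 k : \sum_l MC k l = 1.
  by under eq_bigr do rewrite mxE; rewrite -rmorph_sum/= M_sum1.
have AE : A = quot_mx MC.
  by apply/matrixP => a b; rewrite !mxE rmorphB.
have discA k : (0 < k)%N -> disc_mx (A ^+ k) != 0.
  move=> k0; rewrite /A -rmorphXn/= -(map_disc_mx (real_complex R)).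
  by rewrite fmorph_eq0 disc.
have [rs [Ars urs _]] : exists rs : seq C, [/\ char_poly A = \prod_(r <- rs) ('X - r%:P),
    uniq rs & size rs = n.+1].
  by apply: disc_mx_roots; rewrite -[A]expr1 discA.
have rsP r : (r \in rs) = root (char_poly A) r by rewrite Ars root_prod_XsubC.
have rs1 r : r \in rs -> cnorm r < 1 by rewrite rsP AE; exact: quot_root_lt1.
(* A comes from a real matrix, so its spectrum is stable under conjugation. *)
have rsJ r : r^*%C \in rs -> r \in rs.
  rewrite !rsP => h; have -> : char_poly A = map_poly conjc (char_poly A).
    rewrite /A -(map_char_poly (real_complex R)) -map_poly_comp/=.
    by apply: eq_map_poly => a /=; rewrite oppr0.
  by rewrite -[r]conjcK rmorph_root.
have n1rs : 1 \notin rs by apply/negP => /rs1; rewrite cnorm1 ltxx.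
have [E EM] : exists E : C -> 'M[C]_n.+2, forall k, MC ^+ k = \sum_(r <- 1 :: rs) r ^+ k *: E r.
  apply: exp_mx_distinct_roots; first by rewrite /= n1rs.
  by rewrite big_cons -Ars AE; exact: quot_char_poly_annihilates.
have ME k a b : ((M ^+ k) a b)%:C = E 1 a b + \sum_(r <- rs) E r a b * r ^+ k.
  transitivity ((MC ^+ k) a b); first by rewrite /MC -rmorphXn/= mxE.
  rewrite EM big_cons expr1n scale1r mxE summxE; congr (_ + _).
  by apply: eq_bigr => r _; rewrite mxE mulrC.
have tail a b : forall e : R, 0 < e -> \forall k \near \oo,
    cnorm (((M ^+ k) a b)%:C - E 1 a b) <= e.
  move=> e e0; have : \forall k \near \oo, cnorm (expsum [seq (E r a b, r) | r <- rs] k) <= e.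
    by apply: expsum_cvg0 => // p /mapP[r /rs1 r1 ->].
  by apply: filterS => k; rewrite ME addrC addKr /expsum big_map.
(* [E 1] is a limit of real matrices, hence real; its real part is the limit over R. *)
pose Ms := \matrix_(a, b) complex.Re (E 1 a b).
have MsE a b : (Ms a b)%:C = E 1 a b.
  rewrite mxE [RHS]complexE (_ : complex.Im (E 1 a b) = 0) ?mulr0 ?addr0//.
  apply/eqP; rewrite -normr_le0; apply/ler_addgt0Pl => e e0; rewrite addr0.
  have [k _ /(_ k (leqnn _))] := tail a b e e0; rewrite /= => h; apply: le_trans h.
  case: (E 1 a b) => u v /=; rewrite /cnorm/= -sqrtr_sqr ler_wsqrtr//.
  by rewrite sub0r sqrrN lerDr sqr_ge0.
have limM : limit_matrix M = Ms.
  apply: cvg_lim; first exact: norm_hausdorff.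
  apply: cvg_mx_entries => a b e e0; have e20 : 0 < e / 2 by rewrite divr_gt0.
  apply: filterS (tail a b _ e20) => k h.
  apply: le_lt_trans (_ : e / 2 < e); last by rewrite ltr_pdivrMr// ltr_pMr// ltr1n.
  by rewrite -cnormR real_complexB cnorm_distC MsE.
have ratio r r' k : r \in rs -> r' \in rs -> (0 < k)%N -> r ^+ k = r' ^+ k -> r = r'.
  rewrite !rsP => Ar Ar' k0 e; have A1 : disc_mx A != 0 by rewrite -[A]expr1 discA.
  exact: (eigenvalue_powers_inj A1 (discA _ k0) Ar Ar').
have nres (L : R) (h : nat) (s : seq C) : 0 < L -> (0 < h)%N -> s != [::] ->
    (forall z, z \in s -> cnorm z = L /\ (z \in rs \/ z^*%C \in rs)) ->
    \prod_(z <- s) z != (L ^+ size s)%:C * cis (- (h%:R * log10 L)).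
  (* A resonant product would be an eigenvalue of the Kronecker power of order [size s], at time t =
     ln L. *)
  move=> L0 h0 s0 hs; apply/eqP => e.
  have := nonres (size s) h (ln L); rewrite lt0n size_eq0 => /(_ s0 h0)/negP; apply.
  rewrite /resonance expRM_natl lnK ?posrE// -/(log10 L) -e.
  rewrite map_kron_pow -/A (big_nth 0) big_mkord; apply: kron_pow_root => l.
  have [_] := hs _ (mem_nth 0 (ltn_ord l)).
  by rewrite -rsP => -[|/rsJ].
split.
  apply: (power_sum_benford urs ratio nres (c := fun r => E r i j)) => k.
  rewrite limM (_ : (M ^+ k - Ms) i j = (M ^+ k) i j - Ms i j); last by rewrite !mxE.
  by rewrite real_complexB MsE ME addrC addKr.
(* Differencing multiplies each coefficient by r - 1 and removes base 1. *)
apply: (power_sum_benford urs ratio nres (c := fun r => (r - 1) * E r i j)) => k.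
rewrite (_ : (M ^+ k.+1 - M ^+ k) i j = (M ^+ k.+1) i j - (M ^+ k) i j); last by rewrite !mxE.
rewrite real_complexB !ME opprD addrACA subrr add0r -sumrB; apply: eq_bigr => r _.
by rewrite exprS; ring.
Qed.

End positive_chain.

(** * Null sets of product measures *)

Section product_null_sets.
Context {d1 d2 : measure_display} {T1 : measurableType d1} {T2 : measurableType d2}.
Context {R : realType}.
Local Open Scope ereal_scope.

Lemma measurable_xsection_neq0 (m2 : {sigma_finite_measure set T2 -> \bar R})
  (A : set (T1 * T2)) : measurable A -> measurable [set x | m2 (xsection A x) != 0].
Proof.
move=> mA; rewrite (_ : [set x | _] = ~` ((m2 \o xsection A) @^-1` [set 0])).
  apply: measurableC; rewrite -[X in measurable X]setTI.
  by apply: (measurable_fun_xsection m2 mA) => //; exact: emeasurable_set1.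
by apply/seteqP; split => x /=; [move=> /eqP|move=> h; apply/eqP].
Qed.

Lemma product_null (m1 : {measure set T1 -> \bar R})
    (m2 : {sigma_finite_measure set T2 -> \bar R}) (A : set (T1 * T2)) : measurable A ->
  (m1 \x m2) A = 0 <-> m1 [set x | m2 (xsection A x) != 0] = 0.
Proof.
move=> mA; have mf := measurable_fun_xsection m2 mA.
have := @ae_eq_integral_abs _ _ _ m1 setT measurableT _ mf.
rewrite /product_measure1 (_ : \int[m1]_x `|(m2 \o xsection A) x| =
  \int[m1]_x (m2 \o xsection A) x); last first.
  by apply: eq_integral => x _; rewrite gee0_abs.
move=> ->; have mN := measurable_xsection_neq0 m2 mA; split.
  move=> h; apply/(negligibleP m1 mN); apply: negligibleS h => x /= h.
  by move=> /(_ Logic.I) h'; rewrite h' eqxx in h.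
move=> /(negligibleP m1 mN); apply: negligibleS => x /= /not_implyP[_ h].
exact/eqP.
Qed.

(** The section at x of the pulled back set is the g-preimage of the section of B at f x, so a
    section of B that is not null over f x yields one over x. Serves homotheties and, with identity
    maps, absolute continuity. *)
Lemma product_null_map (m1 n1 : {measure set T1 -> \bar R})
    (m2 n2 : {sigma_finite_measure set T2 -> \bar R}) (f : T1 -> T1) (g : T2 -> T2) :
  measurable_fun setT f -> measurable_fun setT g ->
  (forall B, measurable B -> m1 (f @^-1` B) = 0 -> n1 B = 0) ->
  (forall B, measurable B -> m2 (g @^-1` B) = 0 -> n2 B = 0) ->
  forall B, measurable B ->
    (m1 \x m2) ((fun p => (f p.1, g p.2)) @^-1` B) = 0 -> (n1 \x n2) B = 0.
Proof.
move=> mf mg h1 h2 B mB.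
have mfg : measurable_fun setT (fun p : T1 * T2 => (f p.1, g p.2)).
  apply/measurable_fun_pairP; split.
    exact: (measurableT_comp mf measurable_fst).
  exact: (measurableT_comp mg measurable_snd).
have mfgB : measurable ((fun p : T1 * T2 => (f p.1, g p.2)) @^-1` B).
  by rewrite -[X in measurable X]setTI; exact: mfg.
move=> /(product_null m1 m2 mfgB) h; apply/(product_null n1 n2 mB).
apply: h1; first exact: measurable_xsection_neq0.
have mK := measurable_xsection_neq0 n2 mB.
apply: (subset_measure0 _ _ _ h); last 1 first.
- move=> x /=; apply: contra => /eqP e; apply/eqP; apply: h2; first exact: measurable_xsection.
  by rewrite -[RHS]e; congr (m2 _); apply/seteqP; split => y; rewrite /xsection /= !inE.
- by rewrite -[X in measurable X]setTI; exact: mf.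
- exact: measurable_xsection_neq0.
Qed.

End product_null_sets.

Section rays.
Context {R : realType} {d : measure_display} {U : measurableType d}.
Local Open Scope ereal_scope.

(* Tonelli on [1, 2] x U: almost every dilate of [B] is null. *)
Lemma null_of_countable_rays (mu : {sigma_finite_measure set U -> \bar R})
    (dil : R -> U -> U) (B : set U) :
  measurable_fun setT (fun p : measurableTypeR R * U => dil p.1 p.2) ->
  (forall s, (0 < s)%R -> mu (dil s @^-1` B) = 0 -> mu B = 0) ->
  measurable B ->
  (forall u, countable [set s | (0 < s)%R /\ B (dil s u)]) ->
  mu B = 0.
Proof.
move=> mdil dil_null mB Bc.
pose I : set (measurableTypeR R) := [set` `[1%R, 2%R]].
have mI : measurable I by exact: measurable_itv.
pose E : set (measurableTypeR R * U) := [set p | I p.1 /\ B (dil p.1 p.2)].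
have mE : measurable E.
  rewrite (_ : E = (fst @^-1` I) `&` ((fun p => dil p.1 p.2) @^-1` B))//.
  apply: measurableI.
    by rewrite -[X in measurable X]setTI; exact: measurable_fst.
  by rewrite -[X in measurable X]setTI; exact: mdil.
have E0 : (@lebesgue_measure R \x mu) E = 0.
  (* Integrating first in s: these sections are countable, hence of length 0. *)
  rewrite (@product_measure_unique _ _ _ _ R (@lebesgue_measure R) mu
     (@lebesgue_measure R \x^ mu))//; last first.
    move=> A1 A2 mA1 mA2; exact: product_measure2E.
  rewrite /product_measure2; apply: integral0_eq => u _ /=.
  apply: countable_lebesgue_measure0; apply: sub_countable (Bc u).
  apply: subset_card_le => s; rewrite /ysection/= inE => -[/= + hB]; rewrite /I/=.
  by rewrite in_itv/= => /andP[s1 _]; split => //; exact: lt_le_trans s1.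
have /(product_null _ mu mE) := E0.
(* If [mu B] were nonzero, no dilate with s in [1, 2] would be null, although this interval has
   length 1. *)
apply: contraPP => muB0.
suff : I `<=` [set x | mu (xsection E x) != 0].
  move=> sub h; have := @lebesgue_measure_itv R `[1%R, 2%R].
  rewrite (@subset_measure0 _ _ _ (@lebesgue_measure R) _ _ _ _ sub h)//=; last first.
    exact: measurable_xsection_neq0.
  by rewrite lte_fin ltr1n/= -EFinB => -[]; lra.
move=> s s12 /=; apply/eqP => e; apply: muB0; apply: (dil_null s).
  by move: s12; rewrite /I/= in_itv/= => /andP[s1 _]; exact: lt_le_trans s1.
by rewrite -e; congr (mu _); apply/seteqP; split => u; rewrite /xsection/= inE//=; case.
Qed.

End rays.

Section tuple_product.
Context {d : measure_display} {T : measurableType d} {R : realType}.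
Local Open Scope ereal_scope.

Definition tuple_cons n (p : T * n.-tuple T) : n.+1.-tuple T := [tuple of p.1 :: p.2].

Lemma measurable_tuple_cons n : measurable_fun setT (@tuple_cons n).
Proof.
by apply: (@measurable_cons _ _ _ T fst n snd); [exact: measurable_fst|exact: measurable_snd].
Qed.

Section step.
Context n (mu : {sigma_finite_measure set T -> \bar R})
  (nu : {sigma_finite_measure set (n.-tuple T) -> \bar R}).

Definition cons_measure : set (n.+1.-tuple T) -> \bar R :=
  pushforward (mu \x nu) (@tuple_cons n).

Let cons_measure0 : cons_measure set0 = 0.
Proof. by rewrite /cons_measure /pushforward preimage_set0 measure0. Qed.

Let cons_measure_ge0 A : 0 <= cons_measure A.
Proof. by rewrite /cons_measure /pushforward; exact: measure_ge0. Qed.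

Let cons_measure_sigma_additive : semi_sigma_additive cons_measure.
Proof.
exact: (@measure_semi_sigma_additive _ _ _
  (measure_function_pushforward__canonical__measure_function_Measure
    (mu \x nu) (@measurable_tuple_cons n))).
Qed.

HB.instance Definition _ := isMeasure.Build _ _ _ cons_measure
  cons_measure0 cons_measure_ge0 cons_measure_sigma_additive.

Let cons_measure_sigma_finite : sigma_finite setT cons_measure.
Proof.
have [F FT mF] : sigma_finite setT (mu \x nu) by exact: sigma_finite_product.
pose split (t : n.+1.-tuple T) : T * n.-tuple T := (thead t, [tuple of behead t]).
have splitK t : tuple_cons (split t) = t by rewrite [RHS]tuple_eta.
have consK p : split (tuple_cons p) = p by case: p => x s; congr pair; exact/val_inj.
have msplit : measurable_fun setT split.
  apply/measurable_fun_pairP; split; first exact: (@measurable_tnth _ T n.+1 ord0).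
  exact: measurable_behead.
exists (fun k => split @^-1` F k); first by rewrite -preimage_bigcup -FT preimage_setT.
move=> k; have [mFk Fkoo] := mF k; split.
  by rewrite -[X in measurable X]setTI; exact: msplit.
rewrite /cons_measure /pushforward (_ : _ @^-1` _ = F k)//.
by apply/seteqP; split => p /=; rewrite consK.
Qed.

HB.instance Definition _ := Measure_isSigmaFinite.Build _ _ _ cons_measure
  cons_measure_sigma_finite.

End step.

(** The factors form a sequence on [nat], so that the recursion is a shift; they may differ, as the
    laws of the rows do. *)
Fixpoint tuple_measure (mu : nat -> {sigma_finite_measure set T -> \bar R}) n :
    {sigma_finite_measure set (n.-tuple T) -> \bar R} :=
  if n is m.+1 then cons_measure (mu 0%N) (tuple_measure (fun k => mu k.+1) m)
  else \d_([tuple] : 0.-tuple T).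

Lemma tuple_measure_box (mu : nat -> {sigma_finite_measure set T -> \bar R}) n
    (A : 'I_n -> set T) : (forall i, measurable (A i)) ->
  tuple_measure mu n [set t | forall i, A i (tnth t i)] = \prod_(i < n) mu i (A i).
Proof.
elim: n mu A => [|n IH] mu A mA /=.
  by rewrite big_ord0 diracE mem_set// => -[].
rewrite big_ord_recl/=.
rewrite -(IH (fun k => mu k.+1) (fun i => A (lift ord0 i))) => [|i]; last exact: mA.
rewrite /cons_measure /pushforward.
rewrite (_ : _ @^-1` _ = A ord0 `*` [set t | forall i, A (lift ord0 i) (tnth t i)]).
  rewrite product_measure1E//=.
  rewrite (_ : mkset _ = \bigcap_i ((@tnth n T)^~ i @^-1` A (lift ord0 i))).
    apply: fin_bigcap_measurable => // i _.
    by rewrite -[X in measurable X]setTI; exact: measurable_tnth.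
  by apply/seteqP; split => t /= h i; [move=> _|]; exact: h.
apply/seteqP; split => -[x t] /=.
  move=> h; split; first exact: (h ord0).
  by move=> i; have := h (lift ord0 i); rewrite tnthS.
move=> [h0 h] i; case: (fintype.unliftP ord0 i) => [j|] -> //.
by rewrite /tuple_cons tnthS.
Qed.

End tuple_product.

Section tuple_product_null.
Context {d : measure_display} {T : measurableType d} {R : realType}.
Local Open Scope ereal_scope.

Definition tuple_map n (f : nat -> T -> T) (t : n.-tuple T) : n.-tuple T :=
  [tuple f i (tnth t i) | i < n].

Lemma measurable_tuple_map n (f : nat -> T -> T) : (forall i, measurable_fun setT (f i)) ->
  measurable_fun setT (@tuple_map n f).
Proof.
move=> mf; apply/measurable_fun_tnthP => i; rewrite /comp.
under eq_fun do rewrite tnth_mktuple.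
exact: (measurableT_comp (mf i) (measurable_tnth _)).
Qed.

Lemma tuple_measure_null_map n (mu nu : nat -> {sigma_finite_measure set T -> \bar R})
    (f : nat -> T -> T) : (forall i, measurable_fun setT (f i)) ->
  (forall i B, measurable B -> mu i (f i @^-1` B) = 0 -> nu i B = 0) ->
  forall B, measurable B ->
    tuple_measure mu n (@tuple_map n f @^-1` B) = 0 -> tuple_measure nu n B = 0.
Proof.
elim: n mu nu f => [|n IH] mu nu f mf hf B mB /=.
  have tE (t t' : 0.-tuple T) : t = t' by rewrite (tuple0 t) (tuple0 t').
  rewrite (_ : tuple_map f @^-1` B = B)//; apply/seteqP; split => t /=;
    by rewrite (tE (tuple_map f t) t).
rewrite /cons_measure /pushforward => h.
apply: (product_null_map (mf 0%N) (measurable_tuple_map (fun i => mf i.+1)) (hf 0%N)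
  (IH _ _ _ (fun i => mf i.+1) (fun i => hf i.+1))).
  by rewrite -[X in measurable X]setTI; exact: measurable_tuple_cons.
rewrite -[RHS]h; congr (_ _); apply/seteqP; split => -[x t] /=;
  rewrite (_ : tuple_map f (tuple_cons (x, t)) =
    tuple_cons (f 0%N x, tuple_map (fun i => f i.+1) t))//; apply: eq_from_tnth => i;
  rewrite tnth_mktuple; case: (fintype.unliftP ord0 i) => [j|] ->;
  by rewrite /tuple_cons ?tnthS ?tnth0 ?tnth_mktuple.
Qed.

Definition box n (A : 'I_n -> set T) : set (n.-tuple T) := [set t | forall i, A i (tnth t i)].

Lemma measurable_box n (A : 'I_n -> set T) : (forall i, measurable (A i)) -> measurable (box A).
Proof.
move=> mA; rewrite (_ : box A = \bigcap_i ((@tnth n T)^~ i @^-1` A i)).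
  apply: fin_bigcap_measurable => // i _.
  by rewrite -[X in measurable X]setTI; exact: measurable_tnth.
by apply/seteqP; split => t /= h i; [move=> _|]; exact: h.
Qed.

(** Boxes are stable under intersection, as uniqueness of measures requires of generators; preimages
    under single coordinates are not. *)
Lemma measurable_tuple_boxes n : @measurable _ (n.-tuple T) =
  <<s [set B | exists2 A : 'I_n -> set T, (forall i, measurable (A i)) & B = box A] >>.
Proof.
apply/seteqP; split; last first.
  apply: smallest_sub; first exact: sigma_algebra_measurable.
  by move=> _ [A mA ->]; exact: measurable_box.
apply: smallest_sub; first exact: smallest_sigma_algebra.
move=> B; rewrite -bigcup_seq/= => -[i _ [A mA <-]]; apply: sub_sigma_algebra.
exists (fun j => if j == i then A else setT); first by move=> j; case: ifP.
apply/seteqP; split => t /=.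
  by move=> [_ h] j; case: eqP => // ->.
by move=> /(_ i); rewrite eqxx.
Qed.

End tuple_product_null.

Section joint_law.
Context {d d' : measure_display} {Omega : measurableType d'} {T : measurableType d}.
Context {R : realType} (P : probability Omega R).
Local Open Scope ereal_scope.

(** Independence over the full index set gives the joint law on boxes, which determine a finite
    measure. *)
Lemma joint_law n (Y : 'I_n -> Omega -> T) (law : nat -> {sigma_finite_measure set T -> \bar R}) :
  (forall i, measurable_fun setT (Y i)) -> mutually_independent P Y ->
  (forall (i : 'I_n) B, measurable B -> law i B = P (Y i @^-1` B)) ->
  forall B, measurable B -> P ((fun w => [tuple Y i w | i < n]) @^-1` B) = tuple_measure law n B.
Proof.
move=> mY indY lawE; set Z := fun w => _.
have mZ : measurable_fun setT Z.
  apply/measurable_fun_tnthP => i; rewrite /comp.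
  by under eq_fun do rewrite tnth_mktuple; exact: mY.
pose m1 : {measure set (n.-tuple T) -> \bar R} :=
  measure_function_pushforward__canonical__measure_function_Measure P mZ.
have boxE A : (forall i, measurable (A i)) -> m1 (box A) = tuple_measure law n (box A).
  move=> mA; rewrite tuple_measure_box// /m1/= /pushforward.
  have := indY [set: 'I_n]%SET A mA.
  rewrite (_ : \bigcap_(i in _) _ = Z @^-1` box A); last first.
    apply/seteqP; split => w /= h i; last first.
      by move=> _; have := h i; rewrite /= tnth_mktuple.
    by rewrite tnth_mktuple; apply: (h i); rewrite /= finset.inE.
  move=> ->; apply: eq_big => [i|i _]; first by rewrite finset.inE.
  by rewrite lawE.
apply: (measure_unique _ (fun=> setT) (measurable_tuple_boxes n) _ _ _ m1 (tuple_measure law n)).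
- move=> _ _ [A mA ->] [A' mA' ->]; exists (fun i => A i `&` A' i).
    by move=> i; exact: measurableI.
  by apply/seteqP; split => t /=; [move=> [h h'] i; split|move=> h; split=> i; have [] := h i].
- by move=> _; exists (fun=> setT) => //; apply/seteqP; split.
- by rewrite bigcup_const.
- by move=> _ [A mA ->]; exact: boxE.
- by move=> _; rewrite /m1/= /pushforward preimage_setT probability_setT ltry.
Qed.

Lemma joint_law_null n (Y : 'I_n.+1 -> Omega -> T)
    (mu : {sigma_finite_measure set T -> \bar R}) :
  (forall i, measurable_fun setT (Y i)) -> mutually_independent P Y ->
  (forall i B, measurable B -> mu B = 0 -> P (Y i @^-1` B) = 0) ->
  forall B, measurable B -> tuple_measure (fun=> mu) n.+1 B = 0 ->
    P ((fun w => [tuple Y i w | i < n.+1]) @^-1` B) = 0.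
Proof.
move=> mY indY Ynull B mB B0.
pose Yf i : {mfun Omega >-> T} := HB.pack (Y i) (@isMeasurableFun.Build _ _ _ _ (Y i) (mY i)).
pose law (k : nat) : {sigma_finite_measure set T -> \bar R} := distribution P (Yf (inord k)).
have lawE (i : 'I_n.+1) (C : set T) : measurable C -> law i C = P (Y i @^-1` C).
  by move=> _; rewrite /law/= /distribution/= /pushforward inord_val.
rewrite (joint_law mY indY lawE mB).
apply: (@tuple_measure_null_map _ _ _ _ (fun=> mu) law (fun=> id)) => //.
  by move=> i C mC; exact: Ynull.
rewrite -[RHS]B0; congr (_ _); apply/seteqP; split => t /=;
  by rewrite (_ : tuple_map _ t = t)//; apply: eq_from_tnth => i; rewrite tnth_mktuple.
Qed.

End joint_law.

Section lebesgue.
Context {R : realType}.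
Local Open Scope ereal_scope.

Lemma lebesgue_tupleE n (A : set (n.-tuple R)) :
  lebesgue_tuple n A = tuple_measure (fun=> @lebesgue_measure R) n A.
Proof.
elim: n A => [//|n IH] A; apply: eq_integral => x _; exact: IH.
Qed.

(** s times the measure A |-> lebesgue(f^-1 A), f the homothety, agrees with Lebesgue measure on
    half-open intervals, hence on Borel sets. *)
Lemma lebesgue_measure_dilation_null (c s : R) (B : set (measurableTypeR R)) : (0 < s)%R ->
  measurable B -> lebesgue_measure ((fun x => c + s * (x - c))%R @^-1` B) = 0 ->
  lebesgue_measure B = 0.
Proof.
move=> s0 mB; pose f : measurableTypeR R -> measurableTypeR R := fun x => (c + s * (x - c))%R.
have mf : measurable_fun setT f.
  apply: measurable_realfun.measurable_funD; first exact: measurable_cst.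
  apply: measurable_realfun.measurable_funM; first exact: measurable_cst.
  by apply: measurable_realfun.measurable_funB => //; exact: measurable_cst.
pose m : {measure set (measurableTypeR R) -> \bar R} :=
  mscale (NngNum (ltW s0)) (measure_function_pushforward__canonical__measure_function_Measure
    (@lebesgue_measure R) mf).
have mE X : m X = s%:E * lebesgue_measure (f @^-1` X) by [].
move=> h; rewrite (@lebesgue_measure_unique R m _ B mB); first by rewrite mE h mule0.
move=> _ [[a b] _ <-] /=; rewrite mE.
have -> : f @^-1` `]a, b]%classic = `](c + (a - c) / s)%R, (c + (b - c) / s)%R]%classic.
  apply/seteqP; split => x /=; rewrite !in_itv/= /f => /andP[h1 h2]; apply/andP; split.
  - by rewrite -ltrBrDl ltr_pdivrMr// mulrC ltrBlDl.
  - by rewrite -lerBlDl ler_pdivlMr// mulrC lerBrDl.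
  - by rewrite -ltrBlDl mulrC -ltr_pdivrMr// ltrBrDl.
  - by rewrite -lerBrDl mulrC -ler_pdivlMr// lerBlDl.
rewrite !lebesgue_measure_itv/= !lte_fin ltrD2l ltr_pM2r ?invr_gt0// ltrD2r.
case: ifP => ab; last by rewrite mule0.
by rewrite -!EFinB -EFinM; congr (_%:E); field; rewrite gt_eqF.
Qed.

End lebesgue.

Section matrix_rays.
Context {R : realType}.
Local Open Scope ereal_scope.

Definition dilation d m (c : nat -> nat -> R) (s : R) :
    d.-tuple (m.-tuple R) -> d.-tuple (m.-tuple R) :=
  tuple_map (fun i => tuple_map (fun j (x : R) => (c i j + s * (x - c i j))%R)).

Lemma tnth_dilation d m c s (u : d.-tuple (m.-tuple R)) i j :
  tnth (tnth (dilation c s u) i) j = (c i j + s * (tnth (tnth u i) j - c i j))%R.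
Proof. by rewrite !tnth_mktuple. Qed.

Lemma lebesgue_null_of_rays d m (c : nat -> nat -> R) (B : set (d.-tuple (m.-tuple R))) :
  measurable B ->
  (forall u, countable [set s | (0 < s)%R /\ B (dilation c s u)]) ->
  tuple_measure (fun=> lebesgue_tuple m) d B = 0.
Proof.
move=> mB Bc.
apply: (@null_of_countable_rays _ _ _ (tuple_measure (fun=> lebesgue_tuple m) d)
  (dilation c)) => //.
  apply/measurable_fun_tnthP => i; apply/measurable_fun_tnthP => j.
  rewrite (_ : _ \o _ = fun p : measurableTypeR R * d.-tuple (m.-tuple R) =>
    (c i j + p.1 * (tnth (tnth p.2 i) j - c i j))%R); last first.
    by apply/funext => p /=; rewrite tnth_dilation.
  apply: measurable_realfun.measurable_funD; first exact: measurable_cst.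
  apply: measurable_realfun.measurable_funM; first exact: measurable_fst.
  apply: measurable_realfun.measurable_funB; last exact: measurable_cst.
  apply: (measurableT_comp (measurable_tnth j)).
  exact: (measurableT_comp (measurable_tnth i) measurable_snd).
have mline a s : measurable_fun setT (fun x : R => a + s * (x - a))%R.
  apply: measurable_realfun.measurable_funD; first exact: measurable_cst.
  apply: measurable_realfun.measurable_funM; first exact: measurable_cst.
  by apply: measurable_realfun.measurable_funB => //; exact: measurable_cst.
move=> s s0; apply: (@tuple_measure_null_map _ _ _ _ (fun=> lebesgue_tuple m)
    (fun=> lebesgue_tuple m)) => // i; first exact: measurable_tuple_map.
move=> C mC; rewrite !lebesgue_tupleE.
apply: (@tuple_measure_null_map _ (measurableTypeR R) R m (fun=> lebesgue_measure)
  (fun=> lebesgue_measure) _ (fun j => mline (c i j) s) _ _ mC) => j A mA.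
exact: (lebesgue_measure_dilation_null s0 mA).
Qed.

End matrix_rays.

Section countable_parameters.
Context {R : realType}.

Lemma countable_root (p : {poly R}) : p != 0 -> countable [set s | p.[s] = 0].
Proof.
move=> p0; apply: finite_set_countable.
have [rs prs] := closed_field_poly_normal (map_poly (real_complex R) p).
apply: (@sub_finite_set _ _ [set` [seq complex.Re r | r <- rs]]); last exact: finite_seq.
move=> s /= ps; apply/mapP; exists s%:C => //.
have : root (map_poly (real_complex R) p) s%:C.
  by apply/rootP; rewrite -[s%:C]/(real_complex R s) horner_map/= ps.
by rewrite prs rootZ ?root_prod_XsubC// lead_coef_eq0 map_poly_eq0.
Qed.

(** Two points of a fibre differ by an integer. *)
Lemma countable_phase (w : R[i]) : countable [set x : R | cis x = w].
Proof.
have [[x0 /= x0w]|h] := pselect ([set x : R | cis x = w] !=set0); last first.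
  by apply: sub_countable (countable0 R); apply: subset_card_le => x hx; case: h; exists x.
apply: (@sub_countable _ _ _ (range (fun k : int => x0 + k%:~R))); last first.
  by apply: (sub_countable (card_image_le _ _)); exact: countableP.
have E x : cis x = w -> cis (x - x0) = 1.
  by move=> xw; apply: (mulIf (cis_neq0 x0)); rewrite -cisD subrK mul1r xw x0w.
apply: subset_card_le => x /= /E/cis_eq1 xE; exists (Num.floor (x - x0)) => //.
by rewrite -[LHS]/(x0 + (Num.floor (x - x0))%:~R) -xE addrC subrK.
Qed.

End countable_parameters.

(** * Exceptional matrices *)

Section measurable_matrix_functions.
Context {R : realType} {d : measure_display} {U : measurableType d}.
Implicit Types (F G : U -> {poly R}).

Definition measurable_coefs F := forall i, measurable_fun setT (fun u => (F u)`_i).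

Lemma measurable_coefs_cst p : measurable_coefs (fun=> p).
Proof. by move=> i; exact: measurable_cst. Qed.

Lemma measurable_coefsM F G : measurable_coefs F -> measurable_coefs G ->
  measurable_coefs (fun u => F u * G u).
Proof.
move=> mF mG i; under eq_fun do rewrite coefM.
by apply: measurable_sum => k; apply: measurable_realfun.measurable_funM.
Qed.

Lemma measurable_coefs_sum (I : Type) (s : seq I) (F : I -> U -> {poly R}) :
  (forall i, measurable_coefs (F i)) -> measurable_coefs (fun u => \sum_(i <- s) F i u).
Proof.
move=> mF i; under eq_fun do rewrite coef_sum.
by apply: measurable_sum => k; exact: mF.
Qed.

Lemma measurable_coefs_prod (I : Type) (s : seq I) (F : I -> U -> {poly R}) :
  (forall i, measurable_coefs (F i)) -> measurable_coefs (fun u => \prod_(i <- s) F i u).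
Proof.
move=> mF; elim: s => [|k s IH].
  by under eq_fun do rewrite big_nil; exact: measurable_coefs_cst.
by under eq_fun do rewrite big_cons; exact: measurable_coefsM.
Qed.

Variable n : nat.
Implicit Types (B : U -> 'M[R]_n).

Definition measurable_mx (m : nat) (B : U -> 'M[R]_m) :=
  forall i j, measurable_fun setT (fun u => B u i j).

Lemma measurable_det B : measurable_mx B -> measurable_fun setT (fun u => \det (B u)).
Proof.
move=> mB; apply: measurable_sum => s.
apply: measurable_realfun.measurable_funM; first exact: measurable_cst.
by apply: measurable_prod => i _; exact: mB.
Qed.

Lemma measurable_char_poly B : measurable_mx B -> measurable_coefs (fun u => char_poly (B u)).
Proof.
move=> mB; apply: measurable_coefs_sum => s; apply: measurable_coefsM.
  exact: measurable_coefs_cst.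
apply: measurable_coefs_prod => i k.
under eq_fun do rewrite !mxE coefB coefMn coefC.
apply: measurable_realfun.measurable_funB; first exact: measurable_cst.
by case: eqP => _; [exact: mB|exact: measurable_cst].
Qed.

End measurable_matrix_functions.

Section measurable_matrix_powers.
Context {R : realType} {d : measure_display} {U : measurableType d}.
Variable n : nat.
Implicit Types (B : U -> 'M[R]_n.+1).

Lemma measurable_mxX B k : measurable_mx B -> measurable_mx (fun u => B u ^+ k).
Proof.
move=> mB; elim: k => [|k IH] i j; first by under eq_fun do rewrite expr0; exact: measurable_cst.
under eq_fun do rewrite exprS mxE.
by apply: measurable_sum => l; apply: measurable_realfun.measurable_funM.
Qed.

Lemma measurable_disc_mx B : measurable_mx B -> measurable_fun setT (fun u => disc_mx (B u)).
Proof.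
move=> mB; apply: measurable_det => i j.
(* A sum over a fixed range, whatever the size of the derivative, so that finite sums of measurable
   functions apply. *)
have hE u : horner_mx (B u) (char_poly (B u))^`() =
    \sum_(k < n.+1) ((char_poly (B u))^`())`_k *: B u ^+ k.
  have sz : (size (char_poly (B u))^`() <= n.+1)%N.
    by apply: (leq_trans (size_poly _ _)); rewrite size_char_poly.
  rewrite -[X in horner_mx _ X](coefK (char_poly (B u))^`()) poly_def.
  rewrite (big_ord_widen _ (fun k => _`_k *: 'X^k) sz) big_mkcond rmorph_sum/=.
  apply: eq_bigr => k _; case: ltnP => h.
    by rewrite linearZ/= rmorphXn/= horner_mx_X.
  by rewrite rmorph0 (nth_default _ h) scale0r.
under eq_fun do rewrite hE summxE.
apply: measurable_sum => k; under eq_fun do rewrite mxE coef_deriv -mulr_natr.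
apply: measurable_realfun.measurable_funM; last exact: measurable_mxX.
apply: measurable_realfun.measurable_funM; last exact: measurable_cst.
exact: measurable_char_poly.
Qed.

End measurable_matrix_powers.

Lemma measurable_kron_pow {R : realType} {d : measure_display} {U : measurableType d} n
  (B : U -> 'M[R]_n) j : measurable_mx B -> measurable_mx (fun u => kron_pow (B u) j).
Proof.
move=> mB a b; under eq_fun do rewrite mxE.
by apply: measurable_prod => i _; exact: mB.
Qed.

(** * Resonance as a Borel condition *)

Section resonant_polynomials.
Context {R : realType}.
Variables (j h : nat).
Local Notation toCp := (map_poly (real_complex R)).

Lemma resonanceX t k : (resonance j h t : R[i]) ^+ k = resonance (k * j) (k * h) t.
Proof.
rewrite /resonance exprMn -rmorphXn/= -expRM_natl -cisMn !natrM mulrN.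
by rewrite !mulrA.
Qed.

(** Both parts are linear in the coefficients of p and continuous in t, which gives measurability in
    one variable and continuity in the other. *)
Definition resonance_gap (p : {poly R}) (t : R) : R :=
  `|complex.Re (toCp p).[resonance j h t]| + `|complex.Im (toCp p).[resonance j h t]|.

Lemma resonance_gap_eq0 p t : resonance_gap p t = 0 <-> root (toCp p) (resonance j h t).
Proof.
rewrite /resonance_gap /root; case: (_.[_]) => a b /=; rewrite eq_complex/=; split.
  by move/eqP; rewrite paddr_eq0// !normr_eq0.
by move=> /andP[/eqP -> /eqP ->]; rewrite normr0 addr0.
Qed.

Lemma resonance_hornerE (p : {poly R}) t N : (size p <= N)%N ->
  (toCp p).[resonance j h t] = \sum_(k < N) (p`_k)%:C * resonance (k * j) (k * h) t.
Proof.
move=> pN; rewrite (horner_coef_wide _ (_ : size (toCp p) <= N)%N) ?size_map_poly//.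
by apply: eq_bigr => k _; rewrite coef_map resonanceX.
Qed.

Lemma Re_resonance_horner (p : {poly R}) t N : (size p <= N)%N ->
  complex.Re (toCp p).[resonance j h t] =
    \sum_(k < N) p`_k * complex.Re (resonance (k * j) (k * h) t).
Proof.
move=> pN; rewrite (resonance_hornerE _ pN) (raddf_sum (@complex.Re R : Rcomplex R -> R)).
apply: eq_bigr => k _; case: (resonance _ _ _) => a b /=; by rewrite mul0r subr0.
Qed.

Lemma Im_resonance_horner (p : {poly R}) t N : (size p <= N)%N ->
  complex.Im (toCp p).[resonance j h t] =
    \sum_(k < N) p`_k * complex.Im (resonance (k * j) (k * h) t).
Proof.
move=> pN; rewrite (resonance_hornerE _ pN) (raddf_sum (@complex.Im R : Rcomplex R -> R)).
apply: eq_bigr => k _; case: (resonance _ _ _) => a b /=; by rewrite mul0r addr0.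
Qed.

End resonant_polynomials.

Section resonance_set.
Context {R : realType}.

Lemma continuous_sum_fun (N : nat) (f : 'I_N -> R -> R) : (forall k, continuous (f k)) ->
  continuous (fun t => \sum_(k < N) f k t).
Proof.
move=> hf; elim: N f hf => [|N IH] f hf.
  by under eq_fun do rewrite big_ord0; exact: cst_continuous.
under eq_fun do rewrite big_ord_recl.
by move=> t; apply: continuousD; [exact: hf|apply: IH => k; exact: hf].
Qed.

Lemma continuous_resonance j h :
  continuous (fun t : R => complex.Re (resonance j h t)) /\
  continuous (fun t : R => complex.Im (resonance j h t)).
Proof.
have cexp : continuous (fun t : R => expR (j%:R * t)).
  move=> t; apply: continuous_comp; last exact: continuous_expR.
  by apply: cvgM; [exact: cvg_cst|exact: cvg_id].
have carg : continuous (fun t : R => 2 * pi * - (h%:R * (t / ln 10))).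
  move=> t; apply: cvgM; first exact: cvg_cst.
  apply: cvgN; apply: cvgM; first exact: cvg_cst.
  by apply: cvgM; [exact: cvg_id|exact: cvg_cst].
split.
  rewrite (_ : (fun t => _) = (fun t : R => expR (j%:R * t) * cos (2 * pi * - (h%:R * (t / ln 10))))).
    move=> t; apply: cvgM; first exact: cexp.
    by apply: continuous_comp; [exact: carg|exact: continuous_cos].
  by apply/funext => t; rewrite /resonance /= mul0r subr0.
rewrite (_ : (fun t => _) = (fun t : R => expR (j%:R * t) * sin (2 * pi * - (h%:R * (t / ln 10))))).
  move=> t; apply: cvgM; first exact: cexp.
  by apply: continuous_comp; [exact: carg|exact: continuous_sin].
by apply/funext => t; rewrite /resonance /= mul0r addr0.
Qed.

Lemma continuous_resonance_gap j h (p : {poly R}) : continuous (resonance_gap j h p).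
Proof.
have cRe : continuous (fun t => complex.Re (map_poly (real_complex R) p).[resonance j h t]).
  under eq_fun do rewrite (Re_resonance_horner _ _ _ (leqnn _)).
  apply: continuous_sum_fun => k s; apply: cvgM; first exact: cvg_cst.
  exact: (continuous_resonance _ _).1.
have cIm : continuous (fun t => complex.Im (map_poly (real_complex R) p).[resonance j h t]).
  under eq_fun do rewrite (Im_resonance_horner _ _ _ (leqnn _)).
  apply: continuous_sum_fun => k s; apply: cvgM; first exact: cvg_cst.
  exact: (continuous_resonance _ _).2.
by move=> t; apply: cvgD; apply: cvg_norm; [exact: cRe|exact: cIm].
Qed.

Context {d : measure_display} {U : measurableType d}.
Variables (F : U -> {poly R}) (N : nat).
Hypothesis F_meas : measurable_coefs F.
Hypothesis F_size : forall u, (size (F u) <= N)%N.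

(* A Borel description of the polynomials [F u] with a root on the arc
   [resonance j h t], [|t| <= K]: the gap gets arbitrarily small at rational times. *)
Definition resonance_set (j h K : nat) : set U :=
  \bigcap_k \bigcup_(q : rat) [set u | `|ratr q : R| <= K%:R /\
    resonance_gap j h (F u) (ratr q) < k.+1%:R^-1].

Lemma measurable_resonance_set j h K : measurable (resonance_set j h K).
Proof.
apply: bigcapT_measurable => k; apply: bigcupT_measurable_rat => q.
have [qK|qK] := boolP (`|ratr q : R| <= K%:R); last first.
  by rewrite (_ : [set u | _] = set0)//; apply/seteqP; split => u // [].
rewrite (_ : [set u | _] = (fun u => resonance_gap j h (F u) (ratr q)) @^-1` `]-oo, (k.+1%:R^-1)[).
  rewrite -[X in measurable X]setTI.
  have mG : measurable_fun setT (fun u => resonance_gap j h (F u) (ratr q)).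
    rewrite /resonance_gap; apply: measurable_realfun.measurable_funD.
      apply: measurableT_comp; first exact: measurable_realfun.normr_measurable.
      under eq_fun do rewrite (Re_resonance_horner _ _ _ (F_size _)).
      apply: measurable_sum => l.
      by apply: measurable_realfun.measurable_funM; [exact: F_meas|exact: measurable_cst].
    apply: measurableT_comp; first exact: measurable_realfun.normr_measurable.
    under eq_fun do rewrite (Im_resonance_horner _ _ _ (F_size _)).
    apply: measurable_sum => l.
    by apply: measurable_realfun.measurable_funM; [exact: F_meas|exact: measurable_cst].
  by apply: mG => //; exact: measurable_itv.
by apply/seteqP; split => u /=; rewrite in_itv/=; [move=> []|move=> ?; split].
Qed.

(** The gap attains its minimum on the compact [-K, K]; rational times with arbitrarily small gap
    force it to be 0. *)
Lemma resonance_set_root j h K u : resonance_set j h K u ->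
  exists t, root (map_poly (real_complex R) (F u)) (resonance j h t).
Proof.
move=> uB; have K0 : - (K%:R) <= K%:R :> R by rewrite (@le_trans _ _ 0)// oppr_le0.
have [|t tK tmin] := @EVT_min R (resonance_gap j h (F u)) _ _ K0.
  by apply: continuous_subspaceT => t; exact: continuous_resonance_gap.
exists t; apply/resonance_gap_eq0; apply/eqP; apply: contraT => gt.
have gt0 : 0 < resonance_gap j h (F u) t by rewrite lt_neqAle eq_sym gt addr_ge0.
pose k := Num.trunc (resonance_gap j h (F u) t)^-1.
have hk : k.+1%:R^-1 < resonance_gap j h (F u) t.
  by rewrite -[ltRHS]invrK ltf_pV2 ?posrE ?invr_gt0// truncnS_gt.
have [q _ /= [qK]] := uB k Logic.I.
rewrite ltNge (le_trans (ltW hk))//; apply: tmin.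
by rewrite in_itv/= -ler_norml.
Qed.

Lemma root_resonance_set j h u t :
  root (map_poly (real_complex R) (F u)) (resonance j h t) -> exists K, resonance_set j h K u.
Proof.
(* The margin 1 leaves room in [-K, K] for rationals near t. *)
move=> /resonance_gap_eq0 t0; exists (Num.trunc (`|t| + 1)).+1 => k _.
have tK := truncnS_gt (`|t| + 1); set K := (Num.trunc _).+1 in tK *.
have : \forall s \near t, resonance_gap j h (F u) s < k.+1%:R^-1.
  have h0 : resonance_gap j h (F u) t < k.+1%:R^-1 by rewrite t0 invr_gt0.
  exact: (cvgr_lt _ (@continuous_resonance_gap j h (F u) t) _ h0).
move=> /nbhs_ballP[e /= e0 he].
pose e' := Num.min e 1.
have e'0 : 0 < e' by rewrite lt_min e0 ltr01.
have [q] := @rat_in_itvoo R (t - e') (t + e') ltac:(lra).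
rewrite in_itv/= => /andP[q1 q2]; exists q => //=.
have tq : `|t - ratr q| < e' by rewrite ltr_norml; apply/andP; split; lra.
split; last by apply: he; rewrite /ball/=; apply: lt_le_trans tq _; rewrite ge_min lexx.
have : `|ratr q : R| <= `|t| + `|t - ratr q|.
  by rewrite -[ratr q in leLHS](subKr t); exact: ler_normB.
have : e' <= 1 by rewrite ge_min lexx orbT.
lra.
Qed.

End resonance_set.

Section discriminant_of_diagonal.
Variables (F : fieldType) (m : nat).

(** The derivative of the characteristic polynomial takes at b_i the value of the product of b_i -
    b_k over k <> i. *)
Lemma disc_mx_diag (b : 'rV[F]_m.+1) : injective (b 0) -> disc_mx (diag_mx b) != 0.
Proof.
move=> b_inj; rewrite /disc_mx horner_mx_diag det_diag prodf_seq_neq0.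
apply/allP => i _; rewrite mxE /=.
rewrite char_poly_trig; last first.
  by apply/is_trig_mxP => k l kl; rewrite mxE -val_eqE /= (ltn_eqF kl) mulr0n.
rewrite (bigD1 i)//= derivM derivB derivX derivC subr0 mul1r hornerD hornerM.
rewrite [diag_mx b i i]mxE eqxx mulr1n hornerXsubC subrr mul0r addr0 horner_prod.
rewrite prodf_seq_neq0; apply/allP => k _; apply/implyP => ki.
by rewrite !hornerE mxE eqxx mulr1n subr_eq0 (inj_eq b_inj) eq_sym.
Qed.

Lemma disc_mx_diagX (b : 'rV[F]_m.+1) k : injective (fun i => b 0 i ^+ k) ->
  disc_mx (diag_mx b ^+ k) != 0.
Proof.
move=> bk_inj; rewrite -[diag_mx b]horner_mx_X -rmorphXn/= horner_mx_diag.
by apply: disc_mx_diag => i i'; rewrite !mxE !hornerXn; exact: bk_inj.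
Qed.

End discriminant_of_diagonal.

Section bad_sets.
Context {R : realType}.
Variable n : nat.
Local Notation rows := (n.+2.-tuple (n.+1.-tuple R)).
Local Notation leb := (tuple_measure (fun=> @lebesgue_tuple R n.+1) n.+2).
Implicit Types (u : rows) (s : R).

(** [quot_mx] in the free coordinates, defined for all real rows and not only stochastic ones. *)
Definition rows_quot u : 'M[R]_n.+1 := \matrix_(i, j)
  (tnth (tnth u (lift ord_max i)) j - tnth (tnth u ord_max) j).

Lemma measurable_entry (i : 'I_n.+2) (j : 'I_n.+1) :
  measurable_fun setT (fun u : rows => tnth (tnth u i) j).
Proof. exact: (measurableT_comp (measurable_tnth j) (measurable_tnth i)). Qed.

Lemma measurable_rows_quot : measurable_mx rows_quot.
Proof.
move=> i j; under eq_fun do rewrite mxE.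
by apply: measurable_realfun.measurable_funB; exact: measurable_entry.
Qed.

Lemma measurable_level (f : rows -> R) (a : R) : measurable_fun setT f ->
  measurable [set u | f u = a].
Proof.
move=> mf; rewrite (_ : [set u | _] = f @^-1` [set a])//.
by rewrite -[X in measurable X]setTI; apply: mf => //; exact: measurable_set1.
Qed.

(** In each application p is nonzero because f does not vanish at the centre c, which is the value s
    = 0. *)
Lemma null_zero_set (f : rows -> R) (c : nat -> nat -> R) : measurable_fun setT f ->
  (forall u, exists2 p : {poly R}, p != 0 & forall s, f (dilation c s u) = p.[s]) ->
  leb [set u | f u = 0] = 0%E.
Proof.
move=> mf fp; apply: (lebesgue_null_of_rays (c := c)); first exact: measurable_level.
move=> u; have [p p0 pE] := fp u.
apply: sub_countable (countable_root p0); apply: subset_card_le => s /= [_].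
by rewrite pE.
Qed.

Lemma affine_poly_neq0 (a b : R) : a != 0 -> a%:P + b *: 'X != 0 :> {poly R}.
Proof.
by apply: contraNneq => /(congr1 (horner^~ 0)); rewrite !hornerE => ->.
Qed.

Lemma null_entry (i : 'I_n.+2) (j : 'I_n.+1) :
  leb [set u | tnth (tnth u i) j = 0] = 0%E.
Proof.
apply: (null_zero_set (c := fun _ _ => 1)); first exact: measurable_entry.
move=> u; exists (1%:P + (tnth (tnth u i) j - 1) *: 'X); first exact/affine_poly_neq0/oner_neq0.
by move=> s; rewrite tnth_dilation !hornerE mulrC.
Qed.

Lemma null_last_entry (i : 'I_n.+2) :
  leb [set u | 1 - \sum_j tnth (tnth u i) j = 0] = 0%E.
Proof.
(* Entries 2 give 1 - 2 (n + 1) <> 0 at the centre; entries 1 would give 0 when n = 0. *)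
apply: (null_zero_set (c := fun _ _ => 2)).
  apply: measurable_realfun.measurable_funB; first exact: measurable_cst.
  by apply: measurable_sum => j; exact: measurable_entry.
move=> u; exists ((1 - n.+1%:R * 2)%:P + (- \sum_j (tnth (tnth u i) j - 2)) *: 'X).
  apply: affine_poly_neq0; rewrite -natrM -[1]/(1%:R) subr_eq0 eqr_nat; lia.
move=> s; under eq_bigr do rewrite tnth_dilation.
by rewrite big_split/= sumr_const card_ord -mulr_natl -mulr_sumr !hornerE; ring.
Qed.

Lemma null_disc k : (0 < k)%N -> leb [set u | disc_mx (rows_quot u ^+ k) = 0] = 0%E.
Proof.
(* The centre has last row zero and quotient diag(1, .., n + 1), whose k-th power has distinct
   eigenvalues. *)
move=> k0; pose c (i j : nat) : R := if i == j then i.+1%:R else 0.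
apply: (null_zero_set (c := c)).
  by apply: measurable_disc_mx; apply: measurable_mxX; exact: measurable_rows_quot.
move=> u; pose D : 'M[R]_n.+1 := diag_mx (\row_i i.+1%:R).
pose A : 'M[{poly R}]_n.+1 :=
  map_mx (@polyC R) D + 'X *: map_mx (@polyC R) (rows_quot u - D).
have AE s : map_mx (horner_eval s) A = D + s *: (rows_quot u - D).
  by apply/matrixP => i j; rewrite !mxE /horner_eval !hornerE.
have pE s : (disc_mx (A ^+ k)).[s] = disc_mx ((D + s *: (rows_quot u - D)) ^+ k).
  by rewrite -[LHS]/(horner_eval s _) map_disc_mx rmorphXn/= AE.
exists (disc_mx (A ^+ k)).
  suff : (disc_mx (A ^+ k)).[0] != 0 by apply: contraNneq => ->; rewrite horner0.
  rewrite pE scale0r addr0; apply: disc_mx_diagX => i i' /=; rewrite !mxE => /eqP.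
  by rewrite eqrXn2// eqr_nat eqSS => /eqP/val_inj.
move=> s; rewrite pE; congr (disc_mx (_ ^+ k)).
apply/matrixP => i j; rewrite !mxE !tnth_dilation /c.
have -> : (ord_max : 'I_n.+2) == j :> nat = false by rewrite /= gtn_eqF.
have -> : (lift ord_max i : nat) = i by rewrite /= /bump leqNgt ltn_ord.
rewrite -[i == j]/((i : nat) == j); case: eqP => _; rewrite ?mulr1n ?mulr0n; ring.
Qed.

Lemma rows_quot_dilation0 s u : rows_quot (dilation (fun _ _ => 0) s u) = s *: rows_quot u.
Proof. by apply/matrixP => i j; rewrite !mxE !tnth_dilation; ring. Qed.

Definition rows_kron_poly j u := char_poly (kron_pow (rows_quot u) j).

Lemma measurable_rows_kron_poly j : measurable_coefs (rows_kron_poly j).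
Proof. by apply: measurable_char_poly; apply: measurable_kron_pow; exact: measurable_rows_quot. Qed.

Lemma size_rows_kron_poly j u : (size (rows_kron_poly j u) <= #|{ffun 'I_j -> 'I_n.+1}|.+1)%N.
Proof. by rewrite size_char_poly. Qed.

(* Dilating by [s] multiplies the eigenvalues of the [j]-th Kronecker power by [s ^ j];
   the modulus of the resonance equation then determines the time [t] from [s], and its
   argument leaves countably many [t]. *)
Lemma countable_resonant_scales j h (mu : R[i]) : (0 < j)%N -> (0 < h)%N ->
  countable [set s | 0 < s /\ exists t, resonance j h t = (s ^+ j)%:C * mu].
Proof.
move=> j0 h0.
have jR : j%:R != 0 :> R by rewrite pnatr_eq0 -lt0n.
have hR : h%:R != 0 :> R by rewrite pnatr_eq0 -lt0n.
have l10 : ln 10 != 0 :> R by rewrite gt_eqF// ln10_gt0.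
pose a := ln (cnorm mu) / j%:R.
(* Inverts x = - h t / ln 10 and then t = ln s + a: the scale s is a function of the phase x. *)
pose g (x : R) := expR (- (x / h%:R * ln 10) - a).
apply: (@sub_countable _ _ _ (g @` [set x | cis x = mu / (cnorm mu)%:C])); last first.
  by apply: (sub_countable (card_image_le _ _)); exact: countable_phase.
apply: subset_card_le => s [s0 [t /= e]].
have := congr1 cnorm e; rewrite /resonance !cnormM cnorm_cis mulr1 !cnormR.
rewrite ger0_norm ?expR_ge0// ger0_norm ?exprn_ge0 ?(ltW s0)// => e1.
have mu0 : 0 < cnorm mu.
  rewrite lt_neqAle cnorm_ge0 andbT eq_sym; apply/eqP => z.
  by have := expR_gt0 (j%:R * t); rewrite e1 z mulr0 ltxx.
have tE : t = ln s + a.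
  have := congr1 (@ln R) e1; rewrite expRK lnM ?posrE ?exprn_gt0// lnXn// -[ln s *+ j]mulr_natl.
  by move=> h1; apply: (mulfI jR); rewrite h1 /a; field.
exists (- (h%:R * (t / ln 10))).
  rewrite /=; have muC : (cnorm mu)%:C != 0 by rewrite -[0]/(0%:C) (inj_eq (@complexI R)) gt_eqF.
  have sC : (s ^+ j)%:C != 0 by rewrite -[0]/(0%:C) (inj_eq (@complexI R)) gt_eqF// exprn_gt0.
  apply: (mulfI sC); apply: (mulIf muC); rewrite -!mulrA mulVf// mulr1 -e /resonance e1.
  by rewrite (rmorphM (real_complex R))/=; ring.
rewrite /g (_ : _ - a = ln s) ?lnK//; rewrite tE; by field; rewrite hR l10.
Qed.

(** On a ray from 0, a resonance is s ^ j times one of the finitely many eigenvalues of the fixed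
    matrix [Q], and each of them allows countably many s. *)
Lemma null_resonance_set j h K : (0 < j)%N -> (0 < h)%N ->
  leb (resonance_set (rows_kron_poly j) j h K) = 0%E.
Proof.
move=> j0 h0; apply: (lebesgue_null_of_rays (c := fun _ _ => 0)).
  exact: (measurable_resonance_set (measurable_rows_kron_poly j) (@size_rows_kron_poly j)).
move=> u; set Q := map_mx (real_complex R) (kron_pow (rows_quot u) j).
have [mus Qmus] := closed_field_poly_normal (char_poly Q).
apply: (@sub_countable _ _ _ (\bigcup_(mu in [set` mus])
    [set s | 0 < s /\ exists t, resonance j h t = (s ^+ j)%:C * mu])); last first.
  apply: bigcup_countable; first exact/finite_set_countable/finite_seq.
  by move=> mu _; exact: countable_resonant_scales.
apply: subset_card_le => s [/= s0 /resonance_set_root[t]].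
rewrite /rows_kron_poly rows_quot_dilation0 kron_powZ map_char_poly map_mxZ -/Q.
rewrite -eigenvalue_root_char => /eigenvalueP[v vQ v0].
have sC : (s ^+ j)%:C != 0 :> R[i].
  by rewrite -[0]/(0%:C) (inj_eq (@complexI R)) gt_eqF// exprn_gt0.
exists (resonance j h t / (s ^+ j)%:C) => /=; last first.
  by split => //; exists t; rewrite mulrC divfK.
rewrite -root_prod_XsubC -[\prod_(_ <- _) _]scale1r.
rewrite -[1](monicP (char_poly_monic Q)) -Qmus -eigenvalue_root_char.
apply/eigenvalueP; exists v => //.
apply: (scalerI sC); rewrite scalerA mulrCA divff// mulr1 -vQ -scalemxAr.
by [].
Qed.

End bad_sets.

(** * Random chains *)

Section rows_of_chain.
Context {R : realType} {disp : measure_display} {Omega : measurableType disp}.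
Variables (P : probability Omega R) (n : nat) (X : Omega -> 'M[R]_n.+2).
Hypothesis hX : random_markov_chain X.
Hypothesis hind : mutually_independent P (fun i w => row_tuple (X w) i).
Hypothesis hcont : forall i, continuous_random_vector P (fun w => row_tuple (X w) i).
Local Notation leb := (tuple_measure (fun=> @lebesgue_tuple R n.+1) n.+2).

(* Left inverse of [simplex_chart]: forget the last coordinate. *)
Definition chart_coords (x : n.+2.-tuple R) : n.+1.-tuple R :=
  [tuple tnth x (lift ord_max j) | j < n.+1].

Lemma measurable_chart_coords : measurable_fun setT chart_coords.
Proof.
apply/measurable_fun_tnthP => j; rewrite /comp.
by under eq_fun do rewrite tnth_mktuple; exact: measurable_tnth.
Qed.

Lemma simplex_chartK : cancel (@simplex_chart R n.+2) chart_coords.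
Proof.
move=> y; apply: eq_from_tnth => j; rewrite !tnth_mktuple.
have -> : (lift ord_max j : nat) = j by rewrite /= /bump leqNgt ltn_ord.
by rewrite nth_rcons size_tuple ltn_ord -tnth_nth.
Qed.

Definition coords (i : 'I_n.+2) (w : Omega) := chart_coords (row_tuple (X w) i).

(** Absolute continuity read in the chart: since [chart_coords] inverts the chart, the region to be
    measured is contained in B. *)
Lemma coords_null i B : measurable B -> lebesgue_tuple n.+1 B = 0%E ->
  P (coords i @^-1` B) = 0%E.
Proof.
move=> mB B0; have /null_content_dominatesP := hcont i.
have mpB : measurable (chart_coords @^-1` B).
  by rewrite -[X in measurable X]setTI; exact: measurable_chart_coords.
move=> /(_ _ mpB); apply.
suff E : lebesgue_tuple n.+1
    (@simplex_chart R n.+2 @^-1` (chart_coords @^-1` B `&` @simplex R n.+2)) = 0%E.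
  by rewrite /= /simplex_measure [X in (_ * X)%E]E mule0.
apply: (subset_measure0 _ mB _ B0).
  rewrite -[X in measurable X]setTI; apply: (@measurable_simplex_chart R n.+2) => //.
  by apply: measurableI => //; exact: measurable_simplex.
by move=> y [/= + _]; rewrite simplex_chartK.
Qed.

Lemma measurable_coords i : measurable_fun setT (coords i).
Proof.
apply: (measurableT_comp measurable_chart_coords).
apply/measurable_fun_tnthP => j; rewrite /comp.
by under eq_fun do rewrite tnth_mktuple; exact: hX.1.
Qed.

Lemma coords_indep : mutually_independent P coords.
Proof.
move=> J A mA; have mA' i : measurable (chart_coords @^-1` A i); last exact: (hind J mA').
by rewrite -[X in measurable X]setTI; exact: measurable_chart_coords.
Qed.

Definition all_coords (w : Omega) := [tuple coords i w | i < n.+2].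

Lemma ae_avoid (B : set (n.+2.-tuple (n.+1.-tuple R))) : measurable B -> leb B = 0%E ->
  {ae P, forall w, ~ B (all_coords w)}.
Proof.
move=> mB B0; exists (all_coords @^-1` B); split.
- rewrite -[X in measurable X]setTI.
  have mZ : measurable_fun setT all_coords.
    apply/measurable_fun_tnthP => i; rewrite /comp.
    by under eq_fun do rewrite tnth_mktuple; exact: measurable_coords.
  exact: mZ.
- exact: (joint_law_null measurable_coords coords_indep coords_null mB B0).
- by move=> w /= /contrapT.
Qed.

Lemma tnth_all_coords w i j : tnth (tnth (all_coords w) i) j = X w i (lift ord_max j).
Proof. by rewrite !tnth_mktuple. Qed.

Lemma quot_mx_all_coords w : quot_mx (X w) = rows_quot (all_coords w).
Proof. by apply/matrixP => i j; rewrite !mxE !tnth_all_coords. Qed.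

Lemma ae_benford : {ae P, forall w, benford_matrix (X w)}.
Proof.
have entry : {ae P, forall w, forall i j, tnth (tnth (all_coords w) i) j <> 0}.
  apply: filter_forall => i; apply: filter_forall => j.
  by apply: ae_avoid (null_entry i j); apply: measurable_level; exact: measurable_entry.
have last_entry : {ae P, forall w, forall i, 1 - \sum_j tnth (tnth (all_coords w) i) j <> 0}.
  apply: filter_forall => i; apply: ae_avoid (null_last_entry i); apply: measurable_level.
  apply: measurable_realfun.measurable_funB; first exact: measurable_cst.
  by apply: measurable_sum => j; exact: measurable_entry.
have disc : {ae P, forall w, forall k, (0 < k)%N -> disc_mx (rows_quot (all_coords w) ^+ k) <> 0}.
  apply: ae_foralln => -[|k]; first exact: aeW.
  have : {ae P, forall w, ~ disc_mx (rows_quot (all_coords w) ^+ k.+1) = 0}.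
    apply: ae_avoid (null_disc n (ltn0Sn k)); apply: measurable_level.
    by apply: measurable_disc_mx; apply: measurable_mxX; exact: measurable_rows_quot.
  by apply: filterS => w hw _.
(* There are countably many triples j, h, K, so the null sets can be united. *)
have res : {ae P, forall w, forall j h K, (0 < j)%N -> (0 < h)%N ->
    ~ resonance_set (@rows_kron_poly R n j) j h K (all_coords w)}.
  apply: ae_foralln => j; apply: ae_foralln => h; apply: ae_foralln => K.
  have [j0|j0] := posnP j; first by rewrite j0; exact: aeW.
  have [h0|h0] := posnP h; first by rewrite h0; exact: aeW.
  have : {ae P, forall w, ~ resonance_set (@rows_kron_poly R n j) j h K (all_coords w)}.
    have mB := measurable_resonance_set (measurable_rows_kron_poly (n := n) j)
      (@size_rows_kron_poly R n j) j h K.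
    exact: (ae_avoid mB (null_resonance_set n K j0 h0)).
  by apply: filterS => w hw _ _.
have gen : {ae P, forall w,
    (forall k, (0 < k)%N -> disc_mx (rows_quot (all_coords w) ^+ k) <> 0) /\
    (forall j h K, (0 < j)%N -> (0 < h)%N ->
      ~ resonance_set (@rows_kron_poly R n j) j h K (all_coords w))}.
  by move: disc res; apply: filterS2 => w; exact: conj.
move: entry last_entry gen; apply: filterS3 => w entry last_entry [{}disc {}res].
have [_ stoch] := hX.
have ge0 i j : 0 <= X w i j by have [/(_ j) + _] := stoch w i; rewrite tnth_mktuple.
have sum1 i : \sum_j X w i j = 1.
  have [_ <-] := stoch w i; by apply: eq_bigr => j _; rewrite tnth_mktuple.
apply: positive_generic_benford => // [i j|k k0|j h t j0 h0].
- rewrite lt_neqAle ge0 andbT eq_sym; apply/eqP.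
  (* Entries before the last are coordinates; the last is 1 minus their sum. *)
  have [j' ->|->] := unliftP ord_max j; first by rewrite -tnth_all_coords; exact: entry.
  have := last_entry i; under eq_bigr do rewrite tnth_all_coords.
  by rewrite -(sum1 i) big_lift_max addrC addKr.
- by rewrite quot_mx_all_coords; apply/eqP; exact: disc.
- rewrite quot_mx_all_coords -map_char_poly; apply/negP => hroot.
  have [K hK] := root_resonance_set (F := @rows_kron_poly R n j) hroot.
  exact: (res j h K j0 h0 hK).
Qed.

End rows_of_chain.

Local Close Scope complex_scope.

Theorem theorem2 (R : realType) (d : nat) (hd : (1 < d)%N)
    (disp : measure_display) (Omega : measurableType disp)
    (P : probability Omega R) (X : Omega -> 'M[R]_d)
    (hX : random_markov_chain X)
    (hind : mutually_independent P (fun i w => row_tuple (X w) i))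
    (hcont : forall i, continuous_random_vector P (fun w => row_tuple (X w) i)) :
  {ae P, forall w, benford_matrix (X w)}.
Proof.
by case: d hd X hX hind hcont => [|[|n]] // _ X hX hind hcont; exact: ae_benford.
Qed.
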